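(* Let $0<b_-<b_+<3b_-$ and put $r_0:=\dfrac{(3b_--b_+)^{1/2}}{2b_+}$. Let $b,\tilde b\in\mathbb{B}$, let $a(x):=\int_0^x b(s)\,\mathrm{d}s$ and $\tilde a(x):=\int_0^x\tilde b(s)\,\mathrm{d}s$ for $x\in\mathbb{R}$, and assume that there exists $r\in(0,r_0)$ such that $$\mathrm{supp}(\tilde a-a)\subset[-r,r].$$ If $0$ is an accumulation point of the set $\{\varepsilon\in(0,1] : \lambda_{1,\varepsilon}(0)=\lambda_1(0)\}$, then $\tilde b=b$ (as elements of $L^\infty(\mathbb{R})$).
   Context: Fix real numbers $b_\pm$ with $0<b_-<b_+<3b_-$. $\mathbb{B}$ denotes the (convex) set of non-decreasing real-valued functions $b\in L^\infty(\mathbb{R})$ with $\lim_{x\to\pm\infty}b(x)=b_\pm$. For $b\in\mathbb{B}$, let $a(x):=\int_0^x b(s)\,\mathrm{d}s$. For $\xi\in\mathbb{R}$ let $h(\xi)$ be the self-adjoint operator in $L^2(\mathbb{R})$ which acts as $-\frac{\mathrm{d}^2}{\mathrm{d}x^2}+(\xi-a(x))^2$ on $C_0^\infty(\mathbb{R})$, with domain (independent of $\xi$) $\{u\in H^1(\mathbb{R}) : -u''+a^2u\in L^2(\mathbb{R})\}$. It has compact resolvent and simple eigenvalues $\lambda_1(\xi)<\lambda_2(\xi)<\cdots$, listed in increasing order. Given $b,\tilde b\in\mathbb{B}$ and $\varepsilon\in(0,1]$, put $b_\varepsilon:=(1-\varepsilon)b+\varepsilon\tilde b\in\mathbb{B}$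 and $a_\varepsilon(x):=\int_0^x b_\varepsilon(s)\,\mathrm{d}s$. Then $\lambda_{1,\varepsilon}(\xi)<\lambda_{2,\varepsilon}(\xi)<\cdots$ are the eigenvalues, in increasing order, of the operator $h_\varepsilon(\xi):=-\frac{\mathrm{d}^2}{\mathrm{d}x^2}+(\xi-a_\varepsilon(x))^2$, defined in $L^2(\mathbb{R})$ in the same way as $h(\xi)$ with $b$ replaced by $b_\varepsilon$. *)

(* Defs.v *)
From HB Require Import structures.
From mathcomp Require Import all_boot all_order all_algebra.
From mathcomp Require Import all_classical all_reals all_analysis.
From mathcomp Require Import complex.

Set Implicit Arguments.
Unset Strict Implicit.
Unset Printing Implicit Defensive.

Import Order.TTheory GRing.Theory Num.Theory.
Import numFieldNormedType.Exports.

Local Open Scope classical_set_scope.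
Local Open Scope ring_scope.
Local Open Scope complex_scope.

Local Notation mu := lebesgue_measure.

(* An element of L^oo is given by a representative which is non-decreasing
   everywhere; all notions below depend only on its a.e.-class. *)
Definition magnetic_field (R : realType) (bm bp : R) (b : R -> R) : Prop :=
  [/\ b \in Lfun (@mu R) +oo%E,
      {homo b : x y / x <= y},
      b x @[x --> -oo%R] --> bm
    & b x @[x --> +oo%R] --> bp].

(* The oriented integral of b from 0 to x, with the usual sign for x < 0. *)
Definition potential (R : realType) (b : R -> R) (x : R) : R :=
  if 0 <= x then \int[mu]_(s in `[0, x]) b s
  else - \int[mu]_(s in `[x, 0]) b s.

Definition b_eps (R : realType) (b bt : R -> R) (eps : R) : R -> R :=
  fun x => (1 - eps) * b x + eps * bt x.

Definition tsupport (R : realType) (f : R -> R) : set R :=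
  closure [set x | f x != 0].

(* Real-valued elements of C_0^oo(R); testing against these suffices, also for
   complex-valued functions, by linearity. *)
Definition test_function (R : realType) (phi : R -> R) : Prop :=
  (forall n x, derivable (derive1n n phi) x 1) /\ compact (tsupport phi).

Definition Cintegral (R : realType) (f : R -> R[i]) : R[i] :=
  (\int[mu]_(x in setT) complex.Re (f x)) +i* (\int[mu]_(x in setT) complex.Im (f x)).

Definition L2 (R : realType) (u : R -> R[i]) : Prop :=
  (fun x => complex.Re (u x)) \in Lfun (@mu R) 2%:E /\
  (fun x => complex.Im (u x)) \in Lfun (@mu R) 2%:E.

(* u' = v in the sense of distributions *)
Definition weak_derivative (R : realType) (u v : R -> R[i]) : Prop :=
  forall phi : R -> R, test_function phi ->
    Cintegral (fun x => u x * (derive1 phi x)%:C) =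
    - Cintegral (fun x => v x * (phi x)%:C).

Definition H1 (R : realType) (u : R -> R[i]) : Prop :=
  L2 u /\ exists v, L2 v /\ weak_derivative u v.

(* - u'' + V u = f in the sense of distributions *)
Definition weak_schrodinger (R : realType) (V : R -> R) (u f : R -> R[i]) :
    Prop :=
  forall phi : R -> R, test_function phi ->
    Cintegral (fun x => u x * (- derive1n 2 phi x + V x * phi x)%:C) =
    Cintegral (fun x => f x * (phi x)%:C).

Definition h_domain (R : realType) (b : R -> R) (u : R -> R[i]) : Prop :=
  H1 u /\
  exists f, L2 f /\ weak_schrodinger (fun x => potential b x ^+ 2) u f.

(* the graph of h(xi) : u is in the domain and h(xi) u = f *)
Definition h_op (R : realType) (b : R -> R) (xi : R) (u f : R -> R[i]) : Prop :=
  [/\ h_domain b u, L2 f &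
      weak_schrodinger (fun x => (xi - potential b x) ^+ 2) u f].

(* h(xi) is self-adjoint, so only real eigenvalues need be considered. *)
Definition h_eigenvalue (R : realType) (b : R -> R) (xi l : R) : Prop :=
  exists u : R -> R[i],
    ~ {ae (@mu R), forall x, u x = 0} /\ h_op b xi u (fun x => l%:C * u x).

(* l = lambda_n(xi), numbered from n = 1: l is an eigenvalue and exactly n - 1
   eigenvalues lie strictly below it; there is no need to count multiplicities
   as all eigenvalues are simple. *)
Definition is_lambda (R : realType) (b : R -> R) (n : nat) (xi l : R) : Prop :=
  [/\ (0 < n)%N, h_eigenvalue b xi l &
      card_eq [set m | h_eigenvalue b xi m /\ m < l] `I_n.-1].

(* lambda_{1,eps}(0) = lambda_1(0), both eigenvalues being given by their
   (functional) relation is_lambda *)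
Definition coincidence_set (R : realType) (b bt : R -> R) : set R :=
  [set eps | 0 < eps <= 1 /\
    exists l, is_lambda (b_eps b bt eps) 1 0 l /\ is_lambda b 1 0 l].

(* Main.v *)
Require Import Defs.
From mathcomp Require Import all_boot all_order all_algebra.
From mathcomp Require Import all_classical all_reals all_analysis.
From mathcomp Require Import complex measurable_realfun.
From mathcomp Require Import ring lra.

(** Write a for the potential of b, w for the difference of the potentials of
bt and b, so that w is continuous and vanishes outside [-r, r], and
a + eps w for the potential of b_eps. Whenever eps lies in the coincidence
set, the operators with potentials a and a + eps w share an eigenvalue l, and
l does not depend on eps.

Eigenfunctions are only given as square integrable distributional solutions
with square integrable derivative. A du Bois-Reymond lemma (weak_primitive)
turns them into classical solutions u of u'' = (a^2 - l) u and y of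
y'' = ((a + eps w)^2 - l) y, with u, u', y, y' square integrable
(eigenfunction). From this follow l >= 0 (eigenvalue_ge0) and the vanishing of
the Wronskian u y' - u' y at - r and at r, since outside [-r, r] it is constant
and integrable on a half-line (wronskian_eq0). Thus y may be scaled to have the
same data as u at - r, and its data at r are proportional to those of u.

What remains is a rigidity statement on [-r, r] (robin_rigidity). Put
z = (y - u)/eps and m = w (2 a + eps w), so that
(a + eps w)^2 - a^2 = eps m. Then z'' = ((a + eps w)^2 - l) z + m u, with
z = z' = 0 at - r, and integrating the derivative eps m u y of the Wronskian
gives
    int 2 a w u^2 + eps (int w^2 u^2 + int m u z) = 0.
The second bracket is bounded uniformly in eps. Letting eps tend to 0 along the
coincidence set gives int a w u^2 = 0; dividing by one such eps then gives
int w^2 u^2 = - int m u z. This is the second variation of the eigenvalue. The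
heart of the proof is the estimate
    | int G z | <= (49/50) r^2 int G^2
for z'' = - l z + q z + G with zero initial data at - r, uniform in l >= 0 and
in q with 4 r^2 |q| <= 1 (oscillator_pairing). Since |a| and |a +
    eps w| are at most bp r
on [-r, r], one has m^2 <= 4 bp^2 r^2 w^2, so with G = m u the estimate reads
    int w^2 u^2 <= (49/50) (4 bp^2 r^4) int w^2 u^2,
and the assumption on r yields 2 bp r^2 < 1. Hence w u = 0. The zeros of u are
isolated, so w = 0 and the potentials agree; differentiating them at common
Lebesgue points gives bt = b almost everywhere. *)

Set Implicit Arguments.
Unset Strict Implicit.
Unset Printing Implicit Defensive.

Import Order.TTheory GRing.Theory Num.Theory.
Import numFieldNormedType.Exports.

Local Open Scope classical_set_scope.
Local Open Scope ring_scope.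

(** * Oriented integrals as primitives *)

Section Primitive.
Context {R : realType}.
Local Notation mu := (@lebesgue_measure R).
Implicit Types (f g : R -> R) (x y : R).

Lemma continuous_locally_integrable f : continuous f ->
  locally_integrable setT f.
Proof.
move=> cf; split; [exact: continuous_measurable_fun|exact: openT|].
move=> K _ cK.
have /integrableP[] // : mu.-integrable K (EFin \o f).
by apply: continuous_compact_integrable => //; exact: continuous_subspaceT.
Qed.

Lemma locally_integrable_itv f x y : locally_integrable setT f ->
  mu.-integrable `[x, y] (EFin \o f).
Proof.
move=> [mf _ lf]; apply/integrableP; split.
  by apply/measurable_EFinP; apply: measurable_funS mf.
by apply: lf => //; exact: segment_compact.
Qed.

(** Additivity of the integral, which frees all later arguments from the sign
convention of the oriented integral. *)
Lemma potentialB f x y : locally_integrable setT f -> x <= y ->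
  potential f y - potential f x = \int[mu]_(s in `[x, y]) f s.
Proof.
move=> lf xy.
have split3 (p q r : R) : p <= q -> q <= r ->
    \int[mu]_(s in `[p, r]) f s =
    \int[mu]_(s in `[p, q]) f s + \int[mu]_(s in `[q, r]) f s.
  move=> pq qr; rewrite -(@Rintegral_itv_obnd_cbnd _ q); last first.
    apply: (integrableS _ _ _ (locally_integrable_itv q r lf)) => //.
    exact: subset_itv_oc_cc.
  rewrite -(@Rintegral_itvB _ f (BLeft p) (BRight r) q) ?bnd_simp//.
    by rewrite addrC subrK.
  exact: locally_integrable_itv.
rewrite /potential.
case: (leP 0 x) => x0.
  rewrite (le_trans x0 xy) (split3 0 x y)//.
  by rewrite addrAC subrr add0r.
case: (leP 0 y) => y0.
  by rewrite opprK addrC -split3// ltW.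
by rewrite opprK addrC (split3 x y 0 xy (ltW y0)) addrK.
Qed.

Lemma potential0 f : potential f 0 = 0.
Proof. by rewrite /potential lexx set_itv1 Rintegral_set1. Qed.

(** Near x the potential differs by a constant from an integral with base point
x - 1, to which the Lebesgue differentiation theorem applies. *)
Lemma is_derive_potential_lebesgue_pt f x : locally_integrable setT f ->
  lebesgue_pt f x -> is_derive x 1 (potential f) (f x).
Proof.
move=> lf fx.
pose F y := \int[mu]_(s in `[x - 1, y]) f s.
have x1x : x - 1 < x by rewrite ltrBlDr ltrDl.
have [||||dF F'] := @FTC1_lebesgue_pt _ f (BLeft (x - 1)) x (x + 1).
- by rewrite ltrDl.
- exact: locally_integrable_itv.
- by rewrite lte_fin.
- exact: fx.
apply: (@near_eq_is_derive _ _ _ (fun y => F y + potential f (x - 1))).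
  near=> y; rewrite /F -potentialB ?subrK//.
  by near: y; exact: lt_le_nbhsr.
rewrite derive1E in F'.
have dFx : is_derive x 1 F (f x) := DeriveDef dF F'.
have H := is_deriveD dFx (is_derive_cst (potential f (x - 1)) x 1).
by rewrite addr0 in H.
Unshelve. all: by end_near. Qed.

Lemma is_derive_potential f x : continuous f ->
  is_derive x 1 (potential f) (f x).
Proof.
move=> cf; apply: is_derive_potential_lebesgue_pt.
  exact: continuous_locally_integrable.
apply: (@continuous_lebesgue_pt _ _ _ setT) => //.
- by split => //; exact: openT.
- exact: continuous_measurable_fun.
- exact: cf.
Qed.

Lemma continuous_potential f : locally_integrable setT f ->
  continuous (potential f).
Proof.
move=> lf x.
have x1x : x - 1 < x + 1 by rewrite ltrD2l; lra.
have := @parameterized_integral_continuous _ (x - 1) (x + 1) f (ltW x1x)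
  (locally_integrable_itv _ _ lf).
move=> /(@within_continuous_continuous _ _ _ _ _ _ x x1x) cF.
have {}cF : {for x, continuous
    (fun y => parameterized_integral mu (x - 1) y f)}.
  by apply: cF; rewrite in_itv/=; apply/andP; split; lra.
pose F y := \int[mu]_(s in `[x - 1, y]) f s.
apply: (@cvg_trans _ ((fun y => F y + potential f (x - 1)) @ x)).
  apply: near_eq_cvg; near=> y; rewrite /F -potentialB ?subrK//.
  near: y; apply: lt_le_nbhsr; lra.
have -> : potential f x = F x + potential f (x - 1).
  by rewrite /F -potentialB ?subrK//; lra.
exact: (cvgD cF (cvg_cst _)).
Unshelve. all: by end_near. Qed.

End Primitive.

(** * Derivatives and monotonicity *)

Section Derivatives.
Context {R : realType}.
Implicit Types (f g : R -> R) (x a b c : R).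

(** The next rules restate the derivation rules for functions written
pointwise, so that derive below can match them on the syntax of a body. *)
Lemma is_deriveD1 f g x a b : is_derive x 1 f a -> is_derive x 1 g b ->
  is_derive x 1 (fun t => f t + g t) (a + b).
Proof. exact: is_deriveD. Qed.

Lemma is_deriveN1 f x a : is_derive x 1 f a ->
  is_derive x 1 (fun t => - f t) (- a).
Proof. exact: is_deriveN. Qed.

Lemma is_deriveM1 f g x a b : is_derive x 1 f a -> is_derive x 1 g b ->
  is_derive x 1 (fun t => f t * g t) (a * g x + f x * b).
Proof.
move=> df dg; apply: is_derive_eq (is_deriveM df dg) _.
by rewrite addrC /GRing.scale/=; congr (_ + _); rewrite mulrC.
Qed.

Lemma is_deriveX1 f n x a : is_derive x 1 f a ->
  is_derive x 1 (fun t => f t ^+ n.+1) (n.+1%:R * f x ^+ n * a).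
Proof.
move=> df; have := is_deriveX n.+1 df; rewrite exprfctE => dX.
exact: (is_derive_eq dX).
Qed.

Lemma is_derive_continuous f (f' : R -> R) :
  (forall x, is_derive x 1 f (f' x)) -> continuous f.
Proof.
move=> df x; apply/differentiable_continuous/derivable1_diffP.
by case: (df x).
Qed.

Lemma is_derive_le f (f' : R -> R) a b :
  (forall x, is_derive x 1 f (f' x)) ->
  (forall x, a <= x <= b -> 0 <= f' x) ->
  forall x y, a <= x -> x <= y -> y <= b -> f x <= f y.
Proof.
move=> df f'0 x y ax xy yb.
have cf : {within `[x, y], continuous f}.
  exact/continuous_subspaceT/(is_derive_continuous df).
have [c cxy] := @MVT_segment _ f f' x y xy (fun t _ => df t) cf.
move/eqP; rewrite subr_eq => /eqP ->; rewrite lerDr mulr_ge0 ?subr_ge0//.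
apply: f'0; move: cxy; rewrite in_itv/= => /andP[xc cy].
by rewrite (le_trans ax xc) (le_trans cy yb).
Qed.

(** Comparison principle, to be applied to differences of primitives: this is
    how
most integrals are bounded below. *)
Lemma is_derive_ge0 f (f' : R -> R) a b : (forall x, is_derive x 1 f (f' x)) ->
  (forall x, a <= x <= b -> 0 <= f' x) -> 0 <= f a ->
  forall x, a <= x <= b -> 0 <= f x.
Proof.
move=> df f'0 fa x /andP[ax xb]; apply: (le_trans fa).
exact: (is_derive_le df f'0).
Qed.

Lemma is_derive0_cst f (f' : R -> R) a b : (forall x, is_derive x 1 f (f' x)) ->
  (forall x, a <= x <= b -> f' x = 0) ->
  forall x y, a <= x -> x <= y -> y <= b -> f x = f y.
Proof.
move=> df f'0 x y ax xy yb; apply/eqP; rewrite eq_le; apply/andP; split.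
  by apply: (is_derive_le df _ ax xy yb) => t /f'0 ->.
rewrite -lerN2; apply: (is_derive_le (fun t => is_deriveN1 (df t)) _ ax xy yb).
by move=> t /f'0 ->; rewrite oppr0.
Qed.

Lemma ex_primitive f a : continuous f ->
  exists F : R -> R, F a = 0 /\ forall x, is_derive x 1 F (f x).
Proof.
move=> cf; exists (fun t => potential f t - potential f a); split.
  exact: subrr.
move=> x; apply: is_derive_eq; last exact: addr0.
by apply: is_deriveD1; exact: is_derive_potential.
Qed.

End Derivatives.

(** Instances of is_derive are never inferred here, since a unification up to
conversion could select a hypothesis about another function. *)
Ltac derive_rules :=
  repeat match goal with
  | H : forall x, is_derive x _ ?F _ |- is_derive _ _ ?F _ =>
      notypeclasses refine (H _)
  | H : forall x, is_derive x _ ?F _ |- is_derive _ _ (fun t => ?F t) _ =>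
      notypeclasses refine (H _)
  | |- is_derive _ _ (fun _ => ?c) _ =>
      notypeclasses refine (is_derive_cst _ _ _)
  | |- is_derive _ _ (fun t => t) _ => notypeclasses refine (is_derive_id _ _)
  | |- is_derive _ _ (fun t => @?f t + @?g t) _ =>
      notypeclasses refine (@is_deriveD1 _ f g _ _ _ _ _)
  | |- is_derive _ _ (fun t => @?f t * @?g t) _ =>
      notypeclasses refine (@is_deriveM1 _ f g _ _ _ _ _)
  | |- is_derive _ _ (fun t => - @?f t) _ =>
      notypeclasses refine (@is_deriveN1 _ f _ _ _)
  | |- is_derive _ _ (fun t => (@?f t) ^+ _) _ =>
      notypeclasses refine (@is_deriveX1 _ f _ _ _ _)
  end.
Ltac derive :=
  notypeclasses refine (is_derive_eq _ _); [derive_rules | cbv beta].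

Section Pairing.
Context {R : realType}.
Implicit Types (al L A lam x y t : R).

(** The discriminant argument: the mean value k of p makes
int (p - k)^2 >= 0 equivalent to the claim. *)
Lemma Cauchy_Schwarz_primitive (p P1 P2 : R -> R) (x y : R) :
  (forall t, is_derive t 1 P1 (p t)) ->
  (forall t, is_derive t 1 P2 (p t ^+ 2)) -> x <= y ->
  (P1 y - P1 x) ^+ 2 <= (y - x) * (P2 y - P2 x).
Proof.
move=> d1 d2; rewrite le_eqVlt => /predU1P[->|xy].
  by rewrite !subrr expr0n/= mul0r.
have t0 : 0 < y - x by rewrite subr_gt0.
pose k := (P1 y - P1 x) / (y - x).
have : P2 x - 2 * k * P1 x + k ^+ 2 * x <= P2 y - 2 * k * P1 y + k ^+ 2 * y.
  pose F t := P2 t - 2 * k * P1 t + k ^+ 2 * t.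
  apply: (@is_derive_le _ F (fun t => (p t - k) ^+ 2) x y) => // [t|t _|].
  - rewrite /F; derive; ring.
  - exact: sqr_ge0.
  - exact: ltW.
have -> : P1 y = P1 x + k * (y - x) by rewrite /k divfK ?gt_eqF// addrC subrK.
move=> H; nra.
Qed.

(** The integral of p h over an interval of length L, where h'' = p.
Integrating by parts turns it into the integral of h1 (m - h1), where m
is the final value of h1, and Cauchy-Schwarz on both sides of t bounds this
integrand by (N/2) sqrt (t (L - t)), where N is the integral of p^2 and t is
counted from the left end. Replacing the square root by the mean of t (L - t)/c
and c gives a polynomial bound; c = 2 L / 5 is a rational value close to the
optimal L / sqrt 6. *)
Lemma primitive_pairing (p h1 h J P : R -> R) al L : 0 <= L ->
  (forall t, is_derive t 1 h1 (p t)) -> (forall t, is_derive t 1 h (h1 t)) ->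
  (forall t, is_derive t 1 J (p t * h t)) ->
  (forall t, is_derive t 1 P (p t ^+ 2)) ->
  h1 al = 0 -> h al = 0 ->
  J (al + L) - J al <= 49 / 240 * L ^+ 2 * (P (al + L) - P al).
Proof.
rewrite le_eqVlt => /predU1P[<-|L0].
  by move=> *; rewrite addr0 !subrr mulr0.
move=> dh1 dh dJ dP h1al hal.
set be := al + L; set N := P be - P al; set m := h1 be.
have albe : al <= be by rewrite /be lerDl ltW.
pose c := 2 / 5 * L.
have c0 : 0 < c by rewrite /c mulr_gt0//; lra.
pose B t := N / 4 * ((t - al) * (be - t) / c + c).
have N0 : 0 <= N.
  rewrite /N subr_ge0.
  apply: (is_derive_le dP _ (lexx al) albe (lexx be)) => t _.
  exact: sqr_ge0.
have bound t : al <= t <= be -> h1 t * (m - h1 t) <= B t.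
  move=> /andP[alt tbe].
  have C1 := Cauchy_Schwarz_primitive dh1 dP alt.
  have C2 := Cauchy_Schwarz_primitive dh1 dP tbe.
  rewrite h1al subr0 in C1; rewrite -/m in C2.
  have B0 : 0 <= B t.
    apply: mulr_ge0; first by rewrite divr_ge0.
    by rewrite addr_ge0 ?divr_ge0 ?mulr_ge0 ?subr_ge0// ltW.
  have Pt0 : 0 <= P t - P al.
    rewrite subr_ge0.
    apply: (is_derive_le dP _ (lexx al) alt tbe) => s _; exact: sqr_ge0.
  have Pt1 : 0 <= P be - P t.
    rewrite subr_ge0.
    apply: (is_derive_le dP _ alt tbe (lexx be)) => s _; exact: sqr_ge0.
  have : (h1 t * (m - h1 t)) ^+ 2 <= B t ^+ 2.
    rewrite exprMn.
    apply: (le_trans (ler_pM (sqr_ge0 _) (sqr_ge0 _) C1 C2)).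
    set y := (t - al) * (be - t).
    have y0 : 0 <= y by rewrite mulr_ge0 ?subr_ge0.
    have -> : B t = N / 2 * ((y / c + c) / 2) by rewrite /B -/y; field;
        rewrite gt_eqF.
    have H1 : (P t - P al) * (P be - P t) <= (N / 2) ^+ 2.
      rewrite /N; have := sqr_ge0 (P t - P al - (P be - P t)); lra.
    have H2 : y <= ((y / c + c) / 2) ^+ 2.
      have -> : ((y / c + c) / 2) ^+ 2 = y + ((y / c - c) / 2) ^+ 2.
        by field; rewrite gt_eqF.
      by rewrite lerDl sqr_ge0.
    rewrite exprMn.
    have := ler_pM y0 (mulr_ge0 Pt0 Pt1) H2 H1.
    by rewrite /y; congr (_ <= _); ring.
  move=> H; rewrite (le_trans (ler_norm _))// -(ger0_norm B0).
  by rewrite -ler_sqr ?nnegrE// !real_normK// num_real.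
have [S [Sal dS]] : exists F : R -> R, F al = 0 /\
    forall t, is_derive t 1 F (h1 t ^+ 2).
  apply: ex_primitive.
  apply: (@is_derive_continuous _ _ (fun t => 2 * h1 t * p t)) => t.
  by derive; ring.
(* J - (h1 h - S) is constant, and h1 = m at the right end *)
have JE : J be - J al = m * h be - S be.
  have := @is_derive0_cst _ (fun t => J t - (h1 t * h t - S t)) (fun=> 0) al be.
  move=> /(_ _ (fun _ _ => erefl) al be (lexx _) albe (lexx _)) H.
  rewrite hal Sal in H.
  have {}H := H _; rewrite -/m in H.
  have : J al - (h1 al * 0 - 0) = J be - (m * h be - S be).
    by apply: H => t; derive; ring.
  lra.
(* the primitive of B vanishing at al *)
pose BB t := N / 4 * (((t - al) ^+ 2 / 2 * L - (t - al) ^+ 3 / 3) / c +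
    c * (t - al)).
have : 0 <= BB be - (m * h be - S be).
  apply: (@is_derive_ge0 _ (fun t => BB t - (m * h t - S t))
    (fun t => B t - h1 t * (m - h1 t)) al be) => //; last 3 first.
  - by move=> t /bound; rewrite subr_ge0.
  - by rewrite /BB hal Sal subrr !expr0n/= !(mulr0, mul0r, subr0, addr0).
  - by rewrite albe lexx.
  move=> t; rewrite /BB /B; derive; rewrite /be; field; rewrite gt_eqF//.
rewrite JE subr_ge0 => /le_trans; apply.
rewrite /BB /c /be le_eqVlt; apply/orP; left; apply/eqP; field;
    rewrite gt_eqF//.
Qed.

End Pairing.

(** * The forced oscillator *)

Section Oscillator.
Context {R : realType}.
Implicit Types (al be L A lam x y s t : R).

Lemma continuousM1 (f g : R -> R) : continuous f -> continuous g ->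
  continuous (fun t => f t * g t).
Proof. by move=> cf cg t; exact: (cvgM (cf t) (cg t)). Qed.

Lemma continuousD1 (f g : R -> R) : continuous f -> continuous g ->
  continuous (fun t => f t + g t).
Proof. by move=> cf cg t; exact: (cvgD (cf t) (cg t)). Qed.

Lemma continuousN1 (f : R -> R) : continuous f -> continuous (fun t => - f t).
Proof. by move=> cf t; exact: (cvgN (cf t)). Qed.

Lemma continuous_cst1 (c : R) : continuous (fun _ : R => c).
Proof. by move=> t; exact: cvg_cst. Qed.

Lemma continuous_norm1 (f : R -> R) : continuous f ->
  continuous (fun t => `|f t|).
Proof. by move=> cf t; exact: (cvg_norm (cf t)). Qed.

(** The square root of the energy z1^2 + lam z^2 grows at rate at most |g|,
whatever lam >= 0 is. Adding d^2 under the root makes it differentiable. *)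
Lemma energy_bound (z z1 g f H1 : R -> R) lam al be : 0 <= lam ->
  (forall t, is_derive t 1 z (z1 t)) ->
  (forall t, is_derive t 1 z1 (- lam * z t + g t)) ->
  (forall t, is_derive t 1 H1 (f t)) ->
  (forall t, al <= t <= be -> `|g t| <= f t) ->
  z al = 0 -> z1 al = 0 -> H1 al = 0 ->
  forall t, al <= t <= be -> `|z1 t| <= H1 t.
Proof.
move=> lam0 dz dz1 dH gf zal z1al Hal t /andP[alt tbe].
apply/ler_addgt0Pr => d d0.
pose E t := z1 t ^+ 2 + lam * z t ^+ 2 + d ^+ 2.
have E0 s : 0 < E s.
  apply: ltr_wpDl; last exact: exprn_gt0.
  by rewrite addr_ge0 ?sqr_ge0// mulr_ge0 ?sqr_ge0.
have z1E s : `|z1 s| <= Num.sqrt (E s).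
  rewrite -sqrtr_sqr ler_wsqrtr// /E -addrA lerDl.
  by rewrite addr_ge0 ?sqr_ge0// mulr_ge0 ?sqr_ge0.
apply: (le_trans (z1E t)).
have dE s : is_derive s 1 E (2 * z1 s * g s).
  by rewrite /E; derive; ring.
have dS s : is_derive s 1 (fun s => Num.sqrt (E s))
    (z1 s * g s / Num.sqrt (E s)).
  have := @is_derive1_comp _ _ _ s _ _ (is_derive1_sqrt (E0 s)) (dE s).
  move=> H; apply: (is_derive_eq H).
  rewrite invfM; field.
  by rewrite sqrtr_eq0 -ltNge E0.
have : 0 <= H1 t + d - Num.sqrt (E t).
  apply: (@is_derive_ge0 _ (fun s => H1 s + d - Num.sqrt (E s))
    (fun s => f s - z1 s * g s / Num.sqrt (E s)) al be).
  - by move=> s; derive; ring.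
  - move=> s /gf gs; rewrite subr_ge0 ler_pdivrMr ?sqrtr_gt0//.
    apply: (le_trans (ler_norm _)); rewrite normrM mulrC.
    by rewrite ler_pM.
  - rewrite Hal /E zal z1al expr0n/= mulr0 !add0r sqrtr_sqr gtr0_norm//.
    by rewrite subrr.
  - by rewrite alt tbe.
by rewrite subr_ge0.
Qed.

(** The bound is uniform in lam >= 0. By energy_bound, |z| <= H where
H'' = A |z| + |G|. As H is convex and vanishes at al, its double primitive M
satisfies 6 M <= (t - al)^2 H, whence H <= h + A M <= h + H / 6, where
h'' = |G|. So |z| <= (6/5) h, and primitive_pairing applied to p = |G| gives
the constant (6/5) (49/240) = 49/200. *)
Lemma oscillator_pairing (z z1 q G PGz PGG : R -> R) lam A al L :
  0 <= L -> 0 <= lam -> A * L ^+ 2 <= 1 ->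
  continuous G ->
  (forall t, is_derive t 1 z (z1 t)) ->
  (forall t, is_derive t 1 z1 (- lam * z t + (q t * z t + G t))) ->
  (forall t, al <= t <= al + L -> `|q t| <= A) ->
  z al = 0 -> z1 al = 0 ->
  (forall t, is_derive t 1 PGz (G t * z t)) ->
  (forall t, is_derive t 1 PGG (G t ^+ 2)) ->
  `|PGz (al + L) - PGz al| <= 49 / 200 * L ^+ 2 * (PGG (al + L) - PGG al).
Proof.
move=> L0 lam0 AL cG dz dz1 qA zal z1al dGz dGG.
set be := al + L.
have albe : al <= be by rewrite /be lerDl.
have alI : al <= al <= be by rewrite lexx.
have beI : al <= be <= be by rewrite albe lexx.
have A0 : 0 <= A by apply: le_trans (qA al alI).
have cz := is_derive_continuous dz.
have [H1 [H1al dH1]] := @ex_primitive _ (fun t => A * `|z t| + `|G t|) al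
  (continuousD1 (continuousM1 (@continuous_cst1 A) (continuous_norm1 cz))
     (continuous_norm1 cG)).
have [H [Hal dH]] := ex_primitive al (is_derive_continuous dH1).
have [h1 [h1al dh1]] := ex_primitive al (continuous_norm1 cG).
have [h [hal dh]] := ex_primitive al (is_derive_continuous dh1).
have [M1 [M1al dM1]] := ex_primitive al (is_derive_continuous dH).
have [M [Mal dM]] := ex_primitive al (is_derive_continuous dM1).
have f0 t : 0 <= A * `|z t| + `|G t| by rewrite addr_ge0 ?mulr_ge0.
have z1H t : al <= t <= be -> `|z1 t| <= H1 t.
  apply: (energy_bound lam0 dz dz1 dH1) => // s sI.
  apply: (le_trans (ler_normD _ _)); rewrite lerD2r normrM.
  by rewrite ler_wpM2r// qA.
have zH t : al <= t <= be -> `|z t| <= H t.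
  move=> tI; rewrite ler_norml; apply/andP; split.
    rewrite -subr_ge0 opprK.
    notypeclasses refine (@is_derive_ge0 _ (fun t => z t + H t)
        (fun t => z1 t + H1 t) al be _ _ _ _ tI).
    - by move=> s; derive.
    - by move=> s /z1H; rewrite ler_norml => /andP[]; lra.
    - by rewrite zal Hal addr0.
  rewrite -subr_ge0.
  notypeclasses refine (@is_derive_ge0 _ (fun t => H t - z t)
      (fun t => H1 t - z1 t) al be _ _ _ _ tI).
  - by move=> s; derive.
  - by move=> s /z1H; rewrite ler_norml => /andP[]; lra.
  - by rewrite zal Hal subr0.
(* H vanishes at al and is convex, so it lies below t - al times its slope *)
have H1t t : al <= t <= be -> 0 <= (t - al) * H1 t - H t.
  move=> tI.
  notypeclasses refine (@is_derive_ge0 _ (fun t => (t - al) * H1 t - H t)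
    (fun t => (t - al) * (A * `|z t| + `|G t|)) al be _ _ _ _ tI).
  - by move=> s; derive; ring.
  - by move=> s /andP[als _]; rewrite mulr_ge0// subr_ge0.
  - by rewrite H1al Hal mulr0 subr0.
have HM1 t : al <= t <= be ->
    0 <= 2 * (t - al) * H t + (t - al) ^+ 2 * H1 t - 6 * M1 t.
  move=> tI.
  notypeclasses refine (@is_derive_ge0 _
    (fun t => 2 * (t - al) * H t + (t - al) ^+ 2 * H1 t - 6 * M1 t)
    (fun t => 4 * ((t - al) * H1 t - H t) +
        (t - al) ^+ 2 * (A * `|z t| + `|G t|)) al be _ _ _ _ tI).
  - by move=> s; derive; ring.
  - by move=> s sI; rewrite addr_ge0 // mulr_ge0 ?sqr_ge0 ?H1t.
  - by rewrite subrr Hal M1al expr0n/= !(mulr0, mul0r, addr0, subr0).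
have HM t : al <= t <= be -> 0 <= (t - al) ^+ 2 * H t - 6 * M t.
  move=> tI.
  notypeclasses refine (@is_derive_ge0 _
      (fun t => (t - al) ^+ 2 * H t - 6 * M t)
    (fun t => 2 * (t - al) * H t + (t - al) ^+ 2 * H1 t - 6 * M1 t) al be _ _ _
        _ tI).
  - by move=> s; derive; ring.
  - exact: HM1.
  - by rewrite subrr Hal Mal expr0n/= !mulr0 subr0.
have hH1 t : al <= t <= be -> 0 <= h1 t + A * M1 t - H1 t.
  move=> tI.
  notypeclasses refine (@is_derive_ge0 _ (fun t => h1 t + A * M1 t - H1 t)
    (fun t => A * (H t - `|z t|)) al be _ _ _ _ tI).
  - by move=> s; derive; ring.
  - by move=> s sI; rewrite mulr_ge0// subr_ge0 zH.
  - by rewrite h1al M1al H1al mulr0 addr0 subr0.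
have hH t : al <= t <= be -> 0 <= h t + A * M t - H t.
  move=> tI.
  notypeclasses refine (@is_derive_ge0 _ (fun t => h t + A * M t - H t)
    (fun t => h1 t + A * M1 t - H1 t) al be _ _ _ _ tI).
  - by move=> s; derive; ring.
  - exact: hH1.
  - by rewrite hal Mal Hal mulr0 addr0 subr0.
have zh t : al <= t <= be -> `|z t| <= 6 / 5 * h t.
  move=> tI; have H0 := le_trans (normr_ge0 _) (zH t tI).
  have B1 := HM t tI; have B2 := hH t tI; have B3 := zH t tI.
  have At : A * (t - al) ^+ 2 <= 1.
    apply: le_trans AL; rewrite ler_wpM2l// ler_sqr ?nnegrE ?subr_ge0//;
        move: tI; rewrite /be; lra.
  have B4 : A * (6 * M t) <= H t.
    have : A * (6 * M t) <= A * ((t - al) ^+ 2 * H t).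
      by rewrite ler_wpM2l// -subr_ge0.
    move=> /le_trans; apply; rewrite mulrA -[leRHS]mul1r.
    by rewrite ler_wpM2r.
  lra.
have [J [Jal dJ]] := ex_primitive al
  (continuousM1 (continuous_norm1 cG) (is_derive_continuous dh)).
have dGG' t : is_derive t 1 PGG (`|G t| ^+ 2).
  by rewrite real_normK// num_real.
have := primitive_pairing L0 dh1 dh dJ dGG' h1al hal.
rewrite -/be => PP.
have : `|PGz be - PGz al| <= 6 / 5 * (J be - J al).
  have Gz t : al <= t <= be -> `|G t * z t| <= 6 / 5 * (`|G t| * h t).
    by move=> /zh zt; rewrite normrM mulrCA ler_wpM2l.
  rewrite ler_norml; apply/andP; split.
    have : 0 <= 6 / 5 * (J be - J al) + (PGz be - PGz al).
      notypeclasses refine (@is_derive_ge0 _ (fun t => 6 / 5 * (J t - J al) +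
          (PGz t - PGz al))
        (fun t => 6 / 5 * (`|G t| * h t) + G t * z t) al be _ _ _ _ beI).
      - by move=> s; derive; ring.
      - by move=> s /Gz; rewrite ler_norml => /andP[]; lra.
      - by rewrite !subrr mulr0 addr0.
    lra.
  rewrite -subr_ge0.
  notypeclasses refine (@is_derive_ge0 _
      (fun t => 6 / 5 * (J t - J al) - (PGz t - PGz al))
    (fun t => 6 / 5 * (`|G t| * h t) - G t * z t) al be _ _ _ _ beI).
  - by move=> s; derive; ring.
  - by move=> s /Gz; rewrite ler_norml => /andP[]; lra.
  - by rewrite !subrr mulr0 subr0.
move=> /le_trans; apply.
have : 6 / 5 * (J be - J al) <= 6 / 5 * (49 / 240 * L ^+ 2 * (PGG be - PGG al)).
  by rewrite ler_wpM2l// divr_ge0.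
lra.
Qed.

End Oscillator.

(** * Rigidity on a bounded interval *)

Section ODE.
Context {R : realType}.
Implicit Types (al be L A lam x y s t : R).

(** Gronwall: if |1 + Q| <= k, then (u^2 + u1^2) exp (- k t) is
nonincreasing. *)
Lemma ode_unique_after (u u1 Q : R -> R) x0 x : continuous Q ->
  (forall t, is_derive t 1 u (u1 t)) ->
  (forall t, is_derive t 1 u1 (Q t * u t)) ->
  u x0 = 0 -> u1 x0 = 0 -> x0 <= x -> u x = 0 /\ u1 x = 0.
Proof.
move=> cQ du du1 ux0 u1x0 x0x.
have [c _ Qc] := @EVT_max _ (fun t => `|Q t|) x0 x x0x
  (continuous_subspaceT (continuous_norm1 cQ)).
pose k := 1 + `|Q c|.
have dexp t : is_derive t 1 (fun t => expR (- k * t)) (- k * expR (- k * t)).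
  have dk : is_derive t 1 (fun t => - k * t) (- k) by derive;
      rewrite /GRing.scale/=; ring.
  have := @is_derive1_comp _ _ _ t _ _ (is_derive_expR (- k * t)) dk.
  by move=> H; apply: (is_derive_eq H); rewrite mulrC.
have : 0 <= - ((u x ^+ 2 + u1 x ^+ 2) * expR (- k * x)).
  notypeclasses refine (@is_derive_ge0 _
    (fun t => - ((u t ^+ 2 + u1 t ^+ 2) * expR (- k * t)))
    (fun t => (k * (u t ^+ 2 + u1 t ^+ 2) - 2 * u t * u1 t * (1 + Q t)) * expR
        (- k * t))
    x0 x _ _ _ x _).
  - move=> t; derive; ring.
  - move=> t tI; rewrite mulr_ge0 ?expR_ge0// subr_ge0.
    apply: (le_trans (ler_norm _)); rewrite normrM mulrC.
    have Qt : `|1 + Q t| <= k.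
      by rewrite (le_trans (ler_normD _ _))// normr1 lerD2l Qc.
    rewrite ler_pM//.
    rewrite ler_norml; apply/andP; split.
      by have := sqr_ge0 (u t + u1 t); lra.
    by have := sqr_ge0 (u t - u1 t); lra.
  - by rewrite ux0 u1x0 expr0n/= addr0 mul0r oppr0.
  - by rewrite x0x lexx.
rewrite oppr_ge0 pmulr_lle0 ?expR_gt0// => E0.
have /eqP : u x ^+ 2 + u1 x ^+ 2 = 0.
  by apply/eqP; rewrite eq_le E0 addr_ge0 ?sqr_ge0.
by rewrite paddr_eq0 ?sqr_ge0// !sqrf_eq0 => /andP[/eqP ? /eqP ?].
Qed.

Lemma is_derive_reflect (f f' : R -> R) :
  (forall t, is_derive t 1 f (f' t)) ->
  forall t, is_derive t 1 (fun t => f (- t)) (- f' (- t)).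
Proof.
move=> df t.
have dN : is_derive t 1 (fun t => - t) (-1) by derive.
have H := @is_derive1_comp _ _ _ t _ _ (df (- t)) dN.
by apply: (is_derive_eq H); rewrite mulrN1.
Qed.

Lemma ode_unique (u u1 Q : R -> R) x0 : continuous Q ->
  (forall t, is_derive t 1 u (u1 t)) ->
  (forall t, is_derive t 1 u1 (Q t * u t)) ->
  u x0 = 0 -> u1 x0 = 0 -> forall x, u x = 0 /\ u1 x = 0.
Proof.
move=> cQ du du1 ux0 u1x0 x.
have [x0x|/ltW xx0] := leP x0 x;
    first exact: (ode_unique_after cQ du du1 ux0 u1x0 x0x).
have := @ode_unique_after (fun t => u (- t)) (fun t => - u1 (- t))
  (fun t => Q (- t)) (- x0) (- x).
rewrite !opprK lerN2 u1x0 oppr0 => -[].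
- by move=> t; apply: continuous_comp; [exact: opp_continuous|exact: cQ].
- exact: is_derive_reflect.
- move=> t; have H := is_deriveN1 (is_derive_reflect du1 t).
  by apply: (is_derive_eq H); exact: opprK.
- exact: ux0.
- by [].
- exact: xx0.
- by move=> -> /eqP; rewrite oppr_eq0 => /eqP.
Qed.

Lemma support_interior (w : R -> R) r : continuous w ->
  (forall t, w t != 0 -> - r <= t <= r) ->
  forall t, w t != 0 -> - r < t < r.
Proof.
move=> cw wr t wt.
have [e /= e0 eb] := (nbhs_ballP _ _).1 (cvgr_neq0 (w t) (cw t) wt).
have e2 : `|e / 2| < e by rewrite gtr0_norm ?divr_gt0// ltr_pdivrMr//; lra.
have /wr : w (t + e / 2) != 0 by apply: eb; rewrite /ball/= opprD addNKr normrN.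
have /wr : w (t - e / 2) != 0 by apply: eb; rewrite /ball/= opprB addrC subrK.
lra.
Qed.

(** The rigidity statement on [-r, r]. The solutions y are normalised to
the data of u at - r; the condition at r says that u and y satisfy the same
boundary condition there. Here X, I, P, Q are primitives, vanishing at - r, of
a w u^2, w^2 u^2, m u z and (m u)^2. *)
Lemma robin_rigidity (a w u u1 : R -> R) lam r B :
  0 < r -> 0 <= lam -> 4 * B ^+ 2 * r ^+ 4 <= 1 ->
  continuous a -> continuous w ->
  (forall t, is_derive t 1 u (u1 t)) ->
  (forall t, is_derive t 1 u1 ((a t ^+ 2 - lam) * u t)) ->
  (exists t, u t != 0) ->
  (forall t, - r <= t <= r -> `|a t| <= B * r) ->
  (forall t, w t != 0 -> - r <= t <= r) ->
  (forall d : R, 0 < d -> exists eps : R, [/\ 0 < eps, eps < d,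
     (forall t, - r <= t <= r -> `|a t + eps * w t| <= B * r) &
     exists y y1 : R -> R,
     [/\ (forall t, is_derive t 1 y (y1 t)),
       (forall t, is_derive t 1 y1 (((a t + eps * w t) ^+ 2 - lam) * y t)),
       y (- r) = u (- r), y1 (- r) = u1 (- r) &
       u r * y1 r - u1 r * y r = 0]]) ->
  forall t, w t = 0.
Proof.
move=> r0 lam0 Br ca cw du du1 [t0 ut0] aB wr acc.
have cu := is_derive_continuous du.
have rr : - r <= r by lra.
have nrI : - r <= - r <= r by rewrite lexx.
have rI : - r <= r <= r by rewrite lexx andbT.
have [X [X0 dX]] := ex_primitive (- r)
    (continuousM1 (continuousM1 ca cw) (continuousM1 cu cu)).
have [I [I0 dI]] := ex_primitive (- r)
    (continuousM1 (continuousM1 cw cu) (continuousM1 cw cu)).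
have Ir0 : 0 <= I r.
  notypeclasses refine (@is_derive_ge0 _ I _ (- r) r dI _ _ r rI).
  - by move=> t _; rewrite -expr2 sqr_ge0.
  - by rewrite I0.
(* m is the difference quotient ((a + eps w)^2 - a^2) / eps *)
have key d : 0 < d -> exists eps z : R, [/\ 0 < eps, eps < d,
   `|z| <= 49 / 50 * I r & 2 * X r + eps * (I r + z) = 0].
  move=> /acc[eps [eps0 epsd aeB [y [y1 [dy dy1 y_r y1_r wr0]]]]].
  pose m t := w t * (2 * a t + eps * w t).
  pose z t := (y t - u t) * eps^-1; pose z1 t := (y1 t - u1 t) * eps^-1.
  have cG : continuous (fun t => m t * u t).
    apply: continuousM1 => //; apply: continuousM1 => //.
    by apply: continuousD1; apply: continuousM1 => //; exact: continuous_cst1.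
  have dz t : is_derive t 1 z (z1 t).
    by rewrite /z /z1; derive; ring.
  have dz1 t : is_derive t 1 z1
      (- lam * z t + ((a t + eps * w t) ^+ 2 * z t + m t * u t)).
    by rewrite /z /z1 /m; derive; field; rewrite gt_eqF.
  have [P [P0 dP]] := ex_primitive (- r)
      (continuousM1 cG (is_derive_continuous dz)).
  have [Q [Q0 dQ]] := ex_primitive (- r) (continuousM1 cG cG).
  have dQ' t : is_derive t 1 Q ((m t * u t) ^+ 2).
    by rewrite expr2.
  have L0 : 0 <= 2 * r by rewrite mulr_ge0 ?ltW.
  have AL : (B * r) ^+ 2 * (2 * r) ^+ 2 <= 1.
    by apply: le_trans Br; rewrite le_eqVlt; apply/orP; left; apply/eqP; ring.
  have rE : - r + 2 * r = r by ring.
  have := @oscillator_pairing _ z z1 (fun t => (a t + eps * w t) ^+ 2) _ P Q lam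
    ((B * r) ^+ 2) (- r) (2 * r) L0 lam0 AL cG dz dz1.
  rewrite rE P0 Q0 !subr0 => PQ.
  exists eps, (P r); split => //.
    apply: (le_trans (PQ _ _ _ dP dQ')).
    - move=> t /aeB ?; rewrite ger0_norm ?sqr_ge0//.
      by rewrite -[leLHS]real_normK ?num_real// ler_sqr ?nnegrE//
          (le_trans (normr_ge0 _) (aB _ rI)).
    - by rewrite /z y_r subrr mul0r.
    - by rewrite /z1 y1_r subrr mul0r.
    have QI : Q r <= 4 * B ^+ 2 * r ^+ 2 * I r.
      rewrite -subr_ge0.
      notypeclasses refine (@is_derive_ge0 _
          (fun t => 4 * B ^+ 2 * r ^+ 2 * I t - Q t)
        (fun t => ((2 * (B * r)) ^+ 2 - (a t + (a t + eps * w t)) ^+ 2) *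
            (w t * u t) ^+ 2) (- r) r _ _ _ r rI).
      + by move=> t; derive; rewrite /m; ring.
      + move=> t tI; rewrite mulr_ge0 ?sqr_ge0// subr_ge0.
        rewrite -[leLHS]real_normK ?num_real// ler_sqr ?nnegrE//; last first.
          by rewrite mulr_ge0// (le_trans (normr_ge0 _) (aB _ rI)).
        rewrite (le_trans (ler_normD _ _))//.
        by have := aB _ tI; have := aeB _ tI; lra.
      + by rewrite I0 Q0 mulr0 subr0.
    have : 49 / 200 * (2 * r) ^+ 2 * Q r <= 49 / 200 * (2 * r) ^+ 2 *
        (4 * B ^+ 2 * r ^+ 2 * I r).
      by rewrite ler_wpM2l// mulr_ge0 ?sqr_ge0.
    move=> /le_trans; apply.
    have -> : 49 / 200 * (2 * r) ^+ 2 * (4 * B ^+ 2 * r ^+ 2 * I r) = 49 / 50 *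
        ((4 * B ^+ 2 * r ^+ 4) * I r) by field.
    by rewrite ler_wpM2l// -[leRHS]mul1r ler_wpM2r.
  have dW t : is_derive t 1
      (fun t => u t * y1 t - u1 t * y t - eps * (2 * X t + eps * (I t + P t)))
          0.
    by derive; rewrite /m /z; field; rewrite gt_eqF.
  have E : eps * (2 * X r + eps * (I r + P r)) = 0.
    have := is_derive0_cst dW (fun _ _ => erefl) (lexx _) rr (lexx _).
    by rewrite X0 I0 P0 wr0 y_r y1_r; lra.
  by move/eqP: E; rewrite mulf_eq0 gt_eqF//= => /eqP.
(* |2 X r| <= eps |I r + z| with eps arbitrarily small *)
have Xr : X r = 0.
  apply/eqP; rewrite -normr_eq0 eq_le normr_ge0 andbT;
      apply/ler_addgt0Pr => e e0.
  rewrite add0r.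
  have [|eps [z [eps0 epsd zI /eqP]]] := key (e / (I r + 1)).
    by rewrite divr_gt0// ltr_wpDl.
  rewrite addr_eq0 => /eqP X2.
  have : `|2 * X r| <= 2 * e.
    rewrite X2 normrN normrM gtr0_norm//.
    have : `|I r + z| <= 2 * (I r + 1).
      by rewrite (le_trans (ler_normD _ _))// (ger0_norm Ir0); lra.
    move=> H; apply: le_trans (_ : e / (I r + 1) * (2 * (I r + 1)) <= _).
      by apply: ler_pM => //; exact: ltW.
    by rewrite le_eqVlt; apply/orP; left; apply/eqP; field; lra.
  by rewrite normrM gtr0_norm// ler_pM2l.
have {}Ir0 : I r = 0.
  have [//|eps [z [eps0 epsd zI /eqP]]] := key 1.
  rewrite Xr mulr0 add0r mulf_eq0 gt_eqF//= => /eqP Iz.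
  by move: zI; rewrite ler_norml => /andP[]; lra.
have It t : - r <= t <= r -> I t = 0.
  move=> /andP[rt tr]; apply/eqP; rewrite eq_le; apply/andP; split.
    by rewrite -Ir0; apply: (is_derive_le dI _ rt tr (lexx _)) => s _;
        rewrite -expr2 sqr_ge0.
  by rewrite -I0; apply: (is_derive_le dI _ (lexx _) rt tr) => s _;
      rewrite -expr2 sqr_ge0.
have wu t : - r < t < r -> w t * u t = 0.
  move=> /andP[rt tr].
  have : is_derive t 1 (fun _ : R => 0 : R) (w t * u t * (w t * u t)).
    apply: (@near_eq_is_derive _ _ _ I) => //; near=> s; apply: It.
    apply/andP; split; near: s; [exact: lt_le_nbhsr|exact: lt_le_nbhsl].
  move=> /@derive_val; rewrite derive_cst => /esym/eqP.
  by rewrite mulf_eq0 orbb => /eqP.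
move=> t; apply/eqP/negP => /negP wt.
have nw := cvgr_neq0 (w t) (cw t) wt.
have te := support_interior cw wr wt.
(* u would vanish on an open interval, hence everywhere *)
have ut : \forall s \near t, u s = 0.
  near=> s.
  have ws : w s != 0 by near: s; exact: nw.
  have : w s * u s = 0.
    apply: wu; apply/andP; split; near: s.
      by apply: lt_nbhsr; case/andP: te.
    by apply: lt_nbhsl; case/andP: te.
  by move=> /eqP; rewrite mulf_eq0 (negbTE ws) => /eqP.
have u1t : u1 t = 0.
  have : is_derive t 1 (fun _ : R => 0 : R) (u1 t).
    by apply: (@near_eq_is_derive _ _ _ u).
  by move=> /@derive_val; rewrite derive_cst => /esym.
have cQ : continuous (fun t => a t ^+ 2 - lam).
  have -> : (fun t => a t ^+ 2 - lam) = (fun t => a t * a t + - lam).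
    by apply/funext => s; rewrite expr2.
  by apply: continuousD1; [exact: continuousM1|exact: continuous_cst1].
have [] := ode_unique cQ du du1 (nbhs_singleton ut) u1t t0.
by move/eqP; rewrite (negbTE ut0).
Unshelve. all: by end_near. Qed.

End ODE.

(** * A smooth bump *)

Section Bump.
Context {R : realType}.
Implicit Types (p : {poly R}) (x s t k : R) (n m : nat).

(** The family p(x) D^(-n) exp (- 1 / D), with D = 1 - x^2, cut off outside
]-1, 1[; unlike the single function exp (- 1 / D) it is closed under
derivation. *)
Definition bump n p x : R :=
  if `|x| < 1 then p.[x] * (1 - x ^+ 2) ^- n * expR (- (1 - x ^+ 2)^-1) else 0.

(** Numerator of the derivative of bump n p over D^(n + 2). *)
Definition bump_deriv n p : {poly R} :=
  p^`() * (1 - 'X ^+ 2) ^+ 2 + (2 * n%:R)%:P * 'X * p * (1 - 'X ^+ 2)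
  - 2%:P * 'X * p.

Lemma is_derive_quadratic (f : R -> R) x k :
  (forall t, `|f t| <= k * (t - x) ^+ 2) -> is_derive x 1 f 0.
Proof.
move=> fk; apply/is_derive1_caratheodory.
have fx : f x = 0.
  by apply/eqP; rewrite -normr_le0 (le_trans (fk x))// subrr expr0n/= mulr0.
exists (fun t => f t / (t - x)); split.
- move=> t; rewrite fx subr0; have [->|tx] := eqVneq t x.
    by rewrite subrr mulr0.
  by rewrite divfK// subr_eq0.
- rewrite /prop_for /continuous_at fx mul0r.
  have kc : (`|k| * `|t - x|) @[t --> x] --> (0 : R).
    have := cvgM (cvg_cst `|k|)
        (cvg_norm (cvgB (@cvg_id _ (nbhs x)) (cvg_cst x))).
    by rewrite subrr normr0 mulr0; apply.
  apply/cvgr0Pnorm_le => e e0.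
  move/cvgr0Pnorm_le : kc => /(_ e e0); apply: filterS => t.
  apply: le_trans; rewrite normrM [leRHS]normrM !normr_id.
  have [->|tx] := eqVneq t x; first by rewrite subrr invr0 normr0 !mulr0.
  have tx0 : 0 < `|t - x| by rewrite normr_gt0 subr_eq0.
  rewrite normfV ler_pdivrMr// (le_trans (fk t))// -mulrA -expr2.
  rewrite real_normK ?num_real// ler_wpM2r ?sqr_ge0//; exact: ler_norm.
- by rewrite fx mul0r.
Qed.

Lemma poly_bounded p : exists C : R, forall x, `|x| <= 1 -> `|p.[x]| <= C.
Proof.
elim/poly_ind: p => [|p c [C HC]].
  by exists 0 => x _; rewrite horner0 normr0.
exists (C + `|c|) => x x1; rewrite !hornerE.
rewrite (le_trans (ler_normD _ _))// lerD2r normrM.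
by rewrite -[leRHS]mulr1 ler_pM// HC.
Qed.

(** One term of the exponential series at 1 / s. *)
Lemma expR_inv_bound n s : 0 < s ->
    s ^- n * expR (- s^-1) <= n.+2`!%:R * s ^+ 2.
Proof.
move=> s0; have si : 0 <= s^-1 by rewrite invr_ge0 ltW.
have := expR_ge1Dxn n.+1 si => H.
have {H} : s ^- n.+2 / n.+2`!%:R <= expR s^-1.
  by apply: le_trans H; rewrite exprVn lerDr.
have f0 : 0 < n.+2`!%:R :> R by rewrite ltr0n fact_gt0.
move=> H; rewrite expRN ler_pdivrMr ?expR_gt0//.
have : n.+2`!%:R * s ^+ 2 * (s ^- n.+2 / n.+2`!%:R) <= n.+2`!%:R * s ^+ 2 * expR
    s^-1.
  by rewrite ler_wpM2l// mulr_ge0 ?sqr_ge0 ?ltW.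
apply: le_trans; rewrite le_eqVlt; apply/orP; left; apply/eqP.
by rewrite !exprS; field; rewrite ?expf_neq0 ?gt_eqF.
Qed.

(** At the boundary of the support and beyond, the exponential decay beats
every power of D, and D = (1 - |t|) (1 + |t|) <= 2 |t - x|. *)
Lemma bump_quadratic n p x : 1 <= `|x| ->
  exists k, forall t, `|bump n p t| <= k * (t - x) ^+ 2.
Proof.
move=> x1; have [C HC] := poly_bounded p.
have C0 : 0 <= C by apply: le_trans (normr_ge0 _) (HC 0 _); rewrite normr0.
exists (C * n.+2`!%:R * 4) => t; rewrite /bump; case: ifPn => t1; last first.
  by rewrite normr0 mulr_ge0 ?sqr_ge0// mulr_ge0// mulr_ge0.
have D0 : 0 < 1 - t ^+ 2.
  by rewrite subr_gt0 -real_normK ?num_real// expr_lt1.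
rewrite -mulrA normrM -!mulrA; apply: ler_pM => //; first exact: HC (ltW t1).
rewrite ger0_norm ?mulr_ge0 ?invr_ge0 ?exprn_ge0 ?expR_ge0 ?(ltW D0)//.
apply: (le_trans (expR_inv_bound n D0)); rewrite ler_wpM2l//.
have -> : 4 * (t - x) ^+ 2 = (2 * `|t - x|) ^+ 2.
  by rewrite exprMn real_normK ?num_real//; ring.
rewrite ler_sqr ?nnegrE ?(ltW D0)// ?mulr_ge0//.
have -> : 1 - t ^+ 2 = (1 - `|t|) * (1 + `|t|).
  by rewrite -[in LHS](@real_normK _ t) ?num_real//; ring.
rewrite mulrC; apply: ler_pM.
- by rewrite addr_ge0.
- by rewrite subr_ge0 ltW.
- by have := ltW t1; lra.
- by rewrite distrC (le_trans _ (lerB_dist _ _))// lerD2r.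
Qed.

Lemma is_derive_bump n p x :
  is_derive x 1 (bump n p) (bump n.+2 (bump_deriv n p) x).
Proof.
have [x1|x1] := ltP `|x| 1; last first.
  have [k Hk] := bump_quadratic n p x1.
  rewrite {2}/bump ltNge x1/=; exact: is_derive_quadratic Hk.
have D0 : 0 < 1 - x ^+ 2.
  by rewrite subr_gt0 -real_normK ?num_real// expr_lt1.
have dD : is_derive x 1 (fun t => 1 - t ^+ 2) (- (2 * x)).
  by derive; rewrite /GRing.scale/=; ring.
have dV : is_derive x 1 (fun t => (1 - t ^+ 2)^-1) (2 * x * (1 - x ^+ 2) ^- 2).
  have Dn : 1 - x ^+ 2 != 0 by rewrite gt_eqF.
  apply: DeriveDef; first by apply: derivableV;
      [exact: Dn|exact: (@ex_derive _ _ _ _ _ _ _ dD)].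
  rewrite (@deriveV _ _ (fun t => 1 - t ^+ 2)) ?(@ex_derive _ _ _ _ _ _ _ dD)//.
  by rewrite (@derive_val _ _ _ _ _ _ _ dD) /GRing.scale/=; ring.
have dE : is_derive x 1 (fun t => expR (- (1 - t ^+ 2)^-1))
    (- (2 * x * (1 - x ^+ 2) ^- 2) * expR (- (1 - x ^+ 2)^-1)).
  have := @is_derive1_comp _ _ _ x _ _ (is_derive_expR _) (is_deriveN1 dV).
  by move=> H; apply: (is_derive_eq H); rewrite mulrC.
have dVn : is_derive x 1 (fun t => ((1 - t ^+ 2)^-1) ^+ n)
    (n%:R * ((1 - x ^+ 2)^-1) ^+ n.-1 * (2 * x * (1 - x ^+ 2) ^- 2)).
  case: (n) => [|m]; last exact: is_deriveX1.
  by rewrite !mul0r; exact: is_derive_cst.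
have nx : \forall t \near x, `|t| < 1.
  apply/nbhs_ballP; exists (1 - `|x|); first by rewrite /= subr_gt0.
  move=> t; rewrite /ball/= => xt.
  have := ler_distD x t 0; rewrite !subr0 distrC; lra.
apply: (@near_eq_is_derive _ _ _ (fun t => p.[t] * ((1 - t ^+ 2)^-1) ^+ n *
   expR (- (1 - t ^+ 2)^-1))).
  near=> t; rewrite /bump exprVn ifT//.
  by near: t.
rewrite {1}/bump x1.
have H := is_deriveM1 (is_deriveM1 (is_derive_poly p x) dVn) dE.
apply: (is_derive_eq H).
rewrite /bump_deriv !hornerE/=.
rewrite -!exprVn.
set E := expR _; set D := 1 - x ^+ 2 in D0 *.
have Dn : D != 0 by rewrite gt_eqF.
case: (n) => [|m]; rewrite ?exprS/=; field; rewrite ?expf_neq0//.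
Unshelve. all: by end_near. Qed.

End Bump.

(** * Test functions *)

Section TestFunctions.
Context {R : realType}.
Implicit Types (f phi : R -> R) (x y s t k : R).

Lemma derive1_is_derive f f' : (forall x, is_derive x 1 f (f' x)) ->
  derive1 f = f'.
Proof.
by move=> df; apply/funext => x;
    rewrite derive1E (@derive_val _ _ _ _ _ _ _ (df x)).
Qed.

(** To show that a function is smooth, exhibit a class of differentiable
functions that contains it and is closed under derivation. *)
Lemma derivable_derive1n (C : (R -> R) -> Prop) :
  (forall f, C f -> exists2 f', C f' & forall x, is_derive x 1 f (f' x)) ->
  forall f, C f -> forall n x, derivable (derive1n n f) x 1.
Proof.
move=> HC f Cf n x.
have : C (derive1n n f).
  elim: n => [|n IH]; first by rewrite derive1n0.
  rewrite derive1nS; have [f' Cf' df'] := HC _ IH.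
  by rewrite (derive1_is_derive df').
by move=> /HC[f' _ df']; exact: (@ex_derive _ _ _ _ _ _ _ (df' x)).
Qed.

Lemma is_derive_test_function phi : test_function phi ->
  forall x, is_derive x 1 phi (derive1 phi x).
Proof.
move=> [dphi _] x; have := dphi 0%N x; rewrite derive1n0 => H.
by apply: DeriveDef => //; rewrite derive1E.
Qed.

Lemma test_function_derive1 phi : test_function phi ->
    test_function (derive1 phi).
Proof.
move=> [dphi cphi]; split.
  move=> n x; suff -> : derive1n n (derive1 phi) = derive1n n.+1 phi by [].
  elim: n => [|n IH]; first by rewrite derive1n0 derive1n1.
  by rewrite derive1nS IH derive1nS.
apply: (subclosed_compact _ cphi); first exact: closed_closure.
rewrite /tsupport [X in _ `<=` X](_ :
    _ = closure (closure [set x | phi x != 0])); last first.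
  by apply/closure_id; exact: closed_closure.
apply: closure_subset => x /= dx; apply: contrapT => xs.
have nx : \forall t \near x, phi t = 0.
  have : open (~` closure [set x | phi x != 0]).
    by apply: closed_openC; exact: closed_closure.
  rewrite openE => /(_ x xs); apply: filterS => t /= ts.
  apply/eqP/negP => /negP pt; apply: ts; exact: subset_closure.
move/negP: dx; apply; apply/eqP.
have : is_derive x 1 (fun _ : R => 0 : R) (derive1 phi x).
  apply: (@near_eq_is_derive _ _ _ phi) => //.
  by apply: is_derive_test_function; split.
by move=> /@derive_val; rewrite derive_cst => /esym.
Qed.

Lemma test_function_continuous phi : test_function phi -> continuous phi.
Proof. by move=> /is_derive_test_function/is_derive_continuous. Qed.

Lemma test_function_support phi : test_function phi ->
  exists M : R, 0 < M /\ forall x, phi x != 0 -> - M <= x <= M.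
Proof.
move=> [_ /compact_bounded[M [_ HM]]].
exists (`|M| + 1); split; first by rewrite ltr_wpDl.
move=> x phix; rewrite -ler_norml; apply: (HM (`|M| + 1)).
  by rewrite ltr_pwDr// ler_norm.
exact: subset_closure.
Qed.

Definition smooth_step x := potential (bump 0 1) x - potential (bump 0 1) (- 1).

Lemma bump_ge0 x : 0 <= bump 0 1 x :> R.
Proof.
by rewrite /bump; case: ifP => // _;
    rewrite hornerC expr0 invr1 !mul1r expR_ge0.
Qed.

Lemma bump_le1 x : bump 0 1 x <= 1 :> R.
Proof.
rewrite /bump; case: ifP => // x1; rewrite hornerC expr0 invr1 !mul1r.
rewrite -[leRHS]expR0 ler_expR oppr_le0 invr_ge0 subr_ge0 -real_normK
    ?num_real//.
by rewrite expr_le1// ltW.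
Qed.

Lemma bump_eq0 x : 1 <= `|x| -> bump 0 1 x = 0 :> R.
Proof. by move=> x1; rewrite /bump ltNge x1. Qed.

Lemma continuous_bump n (p : {poly R}) : continuous (bump n p).
Proof. exact: is_derive_continuous (is_derive_bump n p). Qed.

Lemma is_derive_smooth_step x : is_derive x 1 smooth_step (bump 0 1 x).
Proof.
apply: is_derive_eq (addr0 _); apply: is_deriveD1.
exact/is_derive_potential/continuous_bump.
Qed.

Lemma smooth_step_le x y : x <= y -> smooth_step x <= smooth_step y.
Proof.
move=> xy; apply: (is_derive_le is_derive_smooth_step _ (lexx x) xy (lexx y)).
by move=> *; exact: bump_ge0.
Qed.

Lemma smooth_step_left x : x <= - 1 -> smooth_step x = 0.
Proof.
move=> x1; rewrite (is_derive0_cst is_derive_smooth_step _ (lexx x) x1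
    (lexx _)).
  by rewrite /smooth_step subrr.
move=> t /andP[_ t1]; apply: bump_eq0; rewrite ler0_norm; lra.
Qed.

Lemma smooth_step_right x : 1 <= x -> smooth_step x = smooth_step 1.
Proof.
move=> x1; rewrite -(is_derive0_cst is_derive_smooth_step _ (lexx 1) x1
    (lexx _))//.
move=> t /andP[t1 _]; apply: bump_eq0; rewrite ger0_norm; lra.
Qed.

Lemma smooth_step1_gt0 : 0 < smooth_step 1.
Proof.
have l1 : - 1 < 1 :> R by lra.
have cS : {within `[- 1, 1], continuous smooth_step}.
  by apply: continuous_subspaceT;
      exact: is_derive_continuous is_derive_smooth_step.
have [c cI] := MVT l1 (fun t _ => is_derive_smooth_step t) cS.
rewrite [smooth_step (- 1)]smooth_step_left// subr0 => ->.
apply: mulr_gt0; last by lra.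
have c1 : `|c| < 1 by move: cI; rewrite in_itv/= ltr_norml.
by rewrite /bump c1 hornerC expr0 invr1 !mul1r expR_gt0.
Qed.

Lemma smooth_step_ge0 x : 0 <= smooth_step x.
Proof.
have [x1|/ltW x1] := leP x (- 1); first by rewrite smooth_step_left.
by rewrite -(smooth_step_left (lexx (- 1))) smooth_step_le.
Qed.

Lemma smooth_step_le1 x : smooth_step x <= smooth_step 1.
Proof.
have [x1|/ltW x1] := leP x 1; first exact: smooth_step_le.
by rewrite smooth_step_right.
Qed.

(** For y < x and large k, this is a smooth version of the indicator of
[y, x], up to the factor smooth_step 1. *)
Definition plateau y x k t :=
    smooth_step ((t - y) * k) - smooth_step ((t - x) * k).

Lemma is_derive_affine f f' y k : (forall x, is_derive x 1 f (f' x)) ->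
  forall t, is_derive t 1 (fun t => f ((t - y) * k)) (k * f' ((t - y) * k)).
Proof.
move=> df t.
have da : is_derive t 1 (fun t => (t - y) * k) k.
  by derive; rewrite /GRing.scale/=; ring.
have H := @is_derive1_comp _ _ _ t _ _ (df _) da.
by apply: (is_derive_eq H); rewrite mulrC.
Qed.

Lemma is_derive_plateau y x k t : is_derive t 1 (plateau y x k)
  (k * bump 0 1 ((t - y) * k) - k * bump 0 1 ((t - x) * k)).
Proof.
by apply: is_deriveD1; last apply: is_deriveN1;
    exact: is_derive_affine is_derive_smooth_step _.
Qed.

Lemma plateau_support y x k t : 0 < k -> plateau y x k t != 0 ->
  - (`|x| + `|y| + k^-1) <= t <= `|x| + `|y| + k^-1.
Proof.
move=> k0; apply: contraNT; rewrite negb_and -!ltNge => /orP[] tM.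
  have h u : `|u| <= `|x| + `|y| -> smooth_step ((t - u) * k) = 0.
    rewrite ler_norml => /andP[u1 u2]; apply: smooth_step_left.
    rewrite -ler_pdivlMr// mulN1r; lra.
  by rewrite /plateau !h ?subrr// ?lerDl ?lerDr.
have h u : `|u| <= `|x| + `|y| -> smooth_step ((t - u) * k) = smooth_step 1.
  rewrite ler_norml => /andP[u1 u2]; apply: smooth_step_right.
  rewrite -ler_pdivrMr// mul1r; lra.
by rewrite /plateau !h ?subrr// ?lerDl ?lerDr.
Qed.

Lemma test_function_plateau y x k : 0 < k -> test_function (plateau y x k).
Proof.
move=> k0; split.
  (* the derivatives of order at least 1 are combinations of two scaled bumps *)
  pose C f := f = plateau y x k \/ exists n p m q c d,
    f = fun t => c * bump n p ((t - y) * k) + d * bump m q ((t - x) * k).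
  apply: (@derivable_derive1n C); last by left.
  move=> f [->|[n [p [m [q [c [d ->]]]]]]].
    exists (fun t => k * bump 0 1 ((t - y) * k) +
        (- k) * bump 0 1 ((t - x) * k)).
      by right; exists 0, 1, 0, 1, k, (- k).
    by move=> t; rewrite mulNr; exact: is_derive_plateau.
  exists (fun t => (c * k) * bump n.+2 (bump_deriv n p) ((t - y) * k)
    + (d * k) * bump m.+2 (bump_deriv m q) ((t - x) * k)).
    by right; do 6 eexists.
  have d1 := is_derive_affine y k (is_derive_bump n p).
  have d2 := is_derive_affine x k (is_derive_bump m q).
  move=> t; derive; ring.
apply: (subclosed_compact (@closed_closure _ _)
  (@segment_compact _ (- (`|x| + `|y| + k^-1)) (`|x| + `|y| + k^-1))).
rewrite [X in _ `<=` X](_ :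
    _ = closure `[- (`|x| + `|y| + k^-1), `|x| + `|y| + k^-1]); last first.
  by apply/closure_id; exact: interval_closed.
by apply: closure_subset => t /= /(plateau_support k0); rewrite in_itv.
Qed.

End TestFunctions.

(** * Averages at Lebesgue points *)

Section WeakDerivative.
Context {R : realType}.
Local Notation mu := (@lebesgue_measure R).
Implicit Types (f g phi : R -> R) (x y s t k M : R).

Lemma Rintegral_is_derive F f a b : continuous f ->
  (forall t : R, is_derive t (1 : R) F (f t)) -> a <= b ->
  \int[mu]_(t in `[a, b]) f t = F b - F a.
Proof.
move=> cf dF ab; have lf := continuous_locally_integrable cf.
rewrite -potentialB//.
have dP t := is_derive_potential t cf.
have d0 t : is_derive t 1 (fun t => potential f t - F t) 0 by derive;
    rewrite subrr.
have := is_derive0_cst d0 (fun _ _ => erefl) (lexx a) ab (lexx b); lra.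
Qed.

Lemma Rintegral_support f (B : set R) : (forall t, f t != 0 -> B t) ->
  \int[mu]_t f t = \int[mu]_(t in B) f t.
Proof.
move=> fB; rewrite [RHS]Rintegral_mkcond; apply: eq_Rintegral => t _.
rewrite patchE; case: ifPn => //; rewrite notin_setE => Bt.
by apply/eqP/negP => /negP /fB.
Qed.

Lemma continuous_bounded_itv f a b : continuous f ->
  exists C : R, forall t, a <= t <= b -> `|f t| <= C.
Proof.
move=> cf; have [ab|ba] := leP a b.
  have [c _ Hc] := @EVT_max _ (fun t => `|f t|) a b ab
    (continuous_subspaceT (continuous_norm1 cf)).
  by exists `|f c| => t tI; apply: Hc; rewrite in_itv.
by exists 0 => t /andP[/le_trans H /H]; rewrite leNgt ba.
Qed.

Lemma locally_integrableM f g : locally_integrable setT f -> continuous g ->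
  locally_integrable setT (fun t => f t * g t).
Proof.
move=> [mf oT lf] cg; have mg := continuous_measurable_fun cg.
split => //; first exact: measurable_funM.
move=> K KT cK.
have iK : mu.-integrable K (EFin \o f).
  apply/integrableP; split; last exact: lf.
  by apply/measurable_EFinP; exact: measurable_funS mf.
have [M [_ HM]] := compact_bounded cK.
have KM t : K t -> - (`|M| + 1) <= t <= `|M| + 1.
  by move=> Kt; rewrite -ler_norml; apply: HM => //;
      rewrite ltr_pwDr// ler_norm.
have [C HC] := continuous_bounded_itv (- (`|M| + 1)) (`|M| + 1) cg.
have mK := compact_measurable cK.
have /integrableP[] // : mu.-integrable K (EFin \o (fun t => f t * g t)).
have iC := @integrableZl _ _ _ mu K mK C _ iK.
apply: (@le_integrable _ _ _ mu K mK _ _ _ _ iC).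
  apply/measurable_EFinP; apply: (measurable_funS measurableT (@subsetT _ _)).
  exact: measurable_funM.
move=> t Kt /=; rewrite lee_fin !normrM mulrC ler_wpM2r//.
by rewrite (le_trans (HC _ (KM _ Kt)))// ler_norm.
Qed.

Lemma locally_integrable_ball f x r : locally_integrable setT f ->
  mu.-integrable (ball x r) (EFin \o f).
Proof.
move=> lf; apply: integrableS (locally_integrable_itv (x - r) (x + r) lf) => //.
  exact: measurable_ball.
by rewrite ball_itv; exact: subset_itv_oo_cc.
Qed.

Lemma locally_integrable_cst (c : R) : locally_integrable setT (fun _ : R => c).
Proof. by apply: continuous_locally_integrable; exact: continuous_cst1. Qed.

(** The kernel has integral smooth_step 1, is at most k = n + 1 and lives on
the ball of radius 1 / k, so the error is at most twice the mean of |f - f x|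
over that ball, which tends to 0 at a Lebesgue point. *)
Lemma lebesgue_pt_average f x : locally_integrable setT f -> lebesgue_pt f x ->
  (\int[mu]_t (f t * (n.+1%:R * bump 0 1 ((t - x) * n.+1%:R)))) @[n --> \oo]
    --> f x * smooth_step 1.
Proof.
move=> lf fx.
pose k n : R := n.+1%:R.
have k0 n : 0 < k n by rewrite /k ltr0n.
pose psi n t := k n * bump 0 1 ((t - x) * k n).
have cpsi n : continuous (psi n).
  apply: continuousM1; first exact: continuous_cst1.
  apply: is_derive_continuous;
      exact: (is_derive_affine x (k n) (is_derive_bump 0 1)).
have psiB n t : psi n t != 0 -> ball x (k n)^-1 t.
  apply: contraNP => tB; rewrite /psi bump_eq0 ?mulr0//.
  rewrite normrM (gtr0_norm (k0 n)) -ler_pdivrMr// mul1r distrC leNgt.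
  by apply/negP.
have psi1 n t : `|psi n t| <= k n.
  rewrite /psi normrM (gtr0_norm (k0 n)) -[leRHS]mulr1.
  by rewrite (ler_wpM2l (ltW (k0 n)))// ger0_norm ?bump_ge0// bump_le1.
have Ipsi n : \int[mu]_(t in ball x (k n)^-1) psi n t = smooth_step 1.
  rewrite -(Rintegral_support (psiB n)).
  rewrite (@Rintegral_support _ `[x - (k n)^-1, x + (k n)^-1]); last first.
    by move=> t /psiB; rewrite ball_itv; exact: subset_itv_oo_cc.
  have ki : 0 < (k n)^-1 by rewrite invr_gt0.
  have dS := is_derive_affine x (k n) is_derive_smooth_step.
  rewrite (@Rintegral_is_derive _ _ _ _ (cpsi n) dS); last first.
    by rewrite lerD2l (le_trans _ (ltW ki))// oppr_le0 ltW.
  have -> : (x + (k n)^-1 - x) * k n = 1 by field; rewrite gt_eqF.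
  have -> : (x - (k n)^-1 - x) * k n = - 1 by field; rewrite gt_eqF.
  by rewrite [smooth_step (- 1)]smooth_step_left// subr0.
pose D n := \int[mu]_(t in ball x (k n)^-1) `|f t - f x|.
have lfx : locally_integrable setT (fun t => f t - f x).
  exact: (locally_integrableB lf (locally_integrable_cst (f x))).
have lafx : locally_integrable setT (fun t => `|f t - f x|).
  case: lfx => mfx oT Hfx; split => //; first exact: measurableT_comp.
  by move=> K KT cK; under eq_integral do rewrite normr_id; exact: Hfx.
have bound n : `|\int[mu]_t (f t * psi n t) - f x * smooth_step 1| <= k n * D n.
  rewrite (@Rintegral_support _ (ball x (k n)^-1)); last first.
    by move=> t H; apply: (psiB n); apply: contraNneq H => ->; rewrite mulr0.
  have mB := @measurable_ball R x (k n)^-1.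
  rewrite -(Ipsi n) -RintegralZl//; last first.
    exact/locally_integrable_ball/continuous_locally_integrable.
  have lfp := locally_integrableM lf (cpsi n).
  have lcp := locally_integrableM (locally_integrable_cst (f x)) (cpsi n).
  rewrite -RintegralB//; [|exact: locally_integrable_ball|exact:
      locally_integrable_ball].
  have lfxp := locally_integrableM lfx (cpsi n).
  have iB : mu.-integrable (ball x (k n)^-1)
      (EFin \o (fun t => f t * psi n t - f x * psi n t)).
    by apply: locally_integrable_ball; exact: locally_integrableB.
  apply: (le_trans (@le_normr_Rintegral _ _ _ mu _ _ mB iB)).
  rewrite /D -RintegralZl//; last exact: locally_integrable_ball.
  apply: le_Rintegral => //.
  - by exact: (@integrable_norm _ _ _ mu _ _ iB).
  - apply: locally_integrable_ball.
    have := locally_integrableM lafx (@continuous_cst1 R (k n)).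
    by under eq_fun do rewrite mulrC.
  - by move=> t _; rewrite -mulrBl normrM mulrC ler_wpM2r.
have Dcvg : k n * D n @[n --> \oo] --> (0 : R).
  have ffx : (fine \o davg f x) r @[r --> 0^'+] --> (0 : R) by exact: fine_cvg.
  have := (cvg_at_rightP (fine \o davg f x) 0 0).1 ffx (fun n => (k n)^-1).
  have kP : (forall n, 0 < (k n)^-1) /\ (k n)^-1 @[n --> \oo] --> (0 : R).
    split; first by move=> n; rewrite invr_gt0.
    exact: cvg_harmonic.
  move=> /(_ kP) h; have H := cvgM (cvg_cst (2 : R)) h; rewrite mulr0 in H.
  suff E : (fun n => k n * D n) = (fun n => 2 * (fine \o davg f x) (k n)^-1).
    by rewrite E; exact: H.
  apply/funext => n /=.
  rewrite /davg /iavg lebesgue_measure_ball ?invr_ge0 ?(ltW (k0 n))//.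
  have DE : (D n)%:E = (\int[mu]_(t in ball x (k n)^-1) `|(f t - f x)%:E|)%E.
    rewrite /D /Rintegral fineK//.
    apply: (@integrable_fin_num _ _ _ mu _ (@measurable_ball R x (k n)^-1)).
    exact: (locally_integrable_ball _ _ lafx).
  have kn := k0 n.
  rewrite -DE inver mulrn_eq0/= gt_eqF ?invr_gt0//=.
  by field; rewrite gt_eqF.
apply/cvgrPdist_le => e e0.
move/cvgr0Pnorm_le : Dcvg => /(_ e e0); apply: filterS => n De.
by rewrite distrC (le_trans (bound n))// (le_trans (ler_norm _)).
Qed.

End WeakDerivative.

(** * The du Bois-Reymond lemma *)

Section DuBoisReymond.
Context {R : realType}.
Local Notation mu := (@lebesgue_measure R).
Implicit Types (f g phi : R -> R) (x y s t k M : R).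

Lemma continuous_step_affine x k :
    continuous (fun t => smooth_step ((t - x) * k) : R).
Proof.
exact: is_derive_continuous (is_derive_affine x k is_derive_smooth_step).
Qed.

Lemma ae_imp (P Q : R -> Prop) : (forall x, P x -> Q x) ->
  {ae mu, forall x, P x} -> {ae mu, forall x, Q x}.
Proof. by move=> PQ; apply: filterS;
    first exact: (ae_filter_ringOfSetsType mu). Qed.

Lemma ae_and (P Q : R -> Prop) : {ae mu, forall x, P x} ->
  {ae mu, forall x, Q x} -> {ae mu, forall x, P x /\ Q x}.
Proof. by apply: filterI; exact: (ae_filter_ringOfSetsType mu). Qed.

Lemma ae_neq x : {ae mu, forall t, t != x}.
Proof.
exists [set x]; split => //.
  exact: lebesgue_measure_set1.
by move=> t /= /negP; rewrite negbK => /eqP.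
Qed.

(** Dominated convergence: the scaled steps tend to smooth_step 1 on the right
of x and to 0 on its left. *)
Lemma smooth_step_cvg g x M : locally_integrable setT g -> - M <= x <= M ->
  (\int[mu]_(t in `[- M, M]) (g t * smooth_step ((t - x) * n.+1%:R)))
    @[n --> \oo] --> (potential g M - potential g x) * smooth_step 1.
Proof.
move=> lg /andP[Mx xM].
set N := smooth_step 1.
pose f_ n t := (g t * smooth_step ((t - x) * n.+1%:R))%:E.
pose f := EFin \o ((fun t => g t * N) \_ `]x, +oo[).
have lgN := locally_integrableM lg (@continuous_cst1 R N).
have Hf : \int[mu]_(t in `[- M, M]) (fine \o f) t =
    (potential g M - potential g x) * N.
  rewrite (_ : \int[mu]_(t in `[- M, M]) (fine \o f) t =
      \int[mu]_(t in `[- M, M] `&` `]x, +oo[) (g t * N)); last first.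
    by rewrite Rintegral_mkcondr.
  have -> : `[- M, M] `&` `]x, +oo[ = [set` `]x, M]].
    apply/seteqP; split => t /=; rewrite !in_itv/=.
      by move=> [/andP[_ ->] /andP[->]].
    move=> /andP[xt ->]; rewrite xt; split=> //.
    by rewrite (le_trans Mx (ltW xt)).
  rewrite Rintegral_itv_obnd_cbnd; last first.
    apply: (integrableS _ _ _ (locally_integrable_itv x M lgN)) => //.
    exact: subset_itv_oc_cc.
  by rewrite RintegralZr// ?potentialB//; exact: locally_integrable_itv.
have [] := @dominated_convergence _ _ _ mu `[- M, M] (measurable_itv _) f_ f
  (EFin \o (fun t => `|g t * N|)).
- move=> n; apply/measurable_EFinP; apply: (measurable_funS measurableT) => //.
  case: (locally_integrableM lg (@continuous_step_affine x n.+1%:R)) => H _ _.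
  exact: H.
- apply/measurable_EFinP; apply: (measurable_funS measurableT) => //.
  apply/(measurable_restrictT _ _).1 => //.
  by case: lgN => H _ _; exact: measurable_funS H.
- have := ae_neq x; apply: ae_imp => t tx _.
  apply: (@cvg_near_cst _ _ (f t) (fun n => f_ n t)).
  rewrite /f_ /f /= patchE.
  have [xt|xt] := ltP x t.
    rewrite mem_set; last by rewrite /= in_itv/= xt.
    near=> n; congr (_ * _)%:E; apply: smooth_step_right.
    rewrite -ler_pdivrMl ?subr_gt0// mulr1.
    rewrite (@le_trans _ _ n%:R)//; last by rewrite ler_nat.
    by near: n; exact: nbhs_infty_ger.
  have {}xt : t < x by rewrite lt_neqAle tx.
  rewrite memNset; last by rewrite /= in_itv/= andbT => /(lt_trans xt);
      rewrite ltxx.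
  near=> n; suff xn : (t - x) * n.+1%:R <= - 1 by rewrite smooth_step_left//
      mulr0.
  rewrite -lerN2 opprK -mulNr opprB.
  rewrite -ler_pdivrMl ?subr_gt0// mulr1.
  rewrite (@le_trans _ _ n%:R)//; last by rewrite ler_nat.
  by near: n; exact: nbhs_infty_ger.
- exact: (@integrable_norm _ _ _ mu _ _ (locally_integrable_itv (- M) M lgN)).
- apply: nearW => t n _; rewrite /f_ /= lee_fin !normrM ler_wpM2l//.
  by rewrite ger0_norm ?smooth_step_ge0// ger0_norm ?smooth_step_ge0//
      smooth_step_le1.
move=> intf _ cvgf.
rewrite -Hf.
have intfE : (\int[mu]_(t in `[(- M)%R, M]) f t)%E =
    (\int[mu]_(t in `[- M, M]) (fine \o f) t)%:E.
  rewrite /Rintegral fineK//.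
  exact: (@integrable_fin_num _ _ _ mu _ (measurable_itv _) _ intf).
rewrite intfE in cvgf.
exact: (fine_cvg cvgf).
Unshelve. all: by end_near. Qed.

(** Test the weak equation against plateaus between two Lebesgue points x and
y of f. As the plateaus sharpen, the left-hand side tends to the difference of
the values of f, and the right-hand side to that of the potential of g, both
multiplied by smooth_step 1. *)
Lemma weak_primitive f g :
  locally_integrable setT f -> locally_integrable setT g ->
  (forall phi, test_function phi ->
    \int[mu]_t (f t * derive1 phi t) = - \int[mu]_t (g t * phi t)) ->
  exists c : R, {ae mu, forall x, f x = c + potential g x}.
Proof.
move=> lf lg weak.
have [[y fy]|noL] := pselect (exists y, lebesgue_pt f y); last first.
  (* almost every point is a Lebesgue point, so this case is vacuous *)
  exists 0; have := lebesgue_differentiation lf; apply: ae_imp => x fx.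
  by exfalso; apply: noL; exists x.
exists (f y - potential g y).
have := lebesgue_differentiation lf; apply: ae_imp => x fx.
pose M := `|x| + `|y| + 1.
have k0 n : 0 < n.+1%:R :> R by rewrite ltr0n.
have A : (\int[mu]_t (f t * (n.+1%:R * bump 0 1 ((t - y) * n.+1%:R)))
   - \int[mu]_t (f t * (n.+1%:R * bump 0 1 ((t - x) * n.+1%:R)))) @[n --> \oo]
   --> f y * smooth_step 1 - f x * smooth_step 1.
  exact: (cvgB (lebesgue_pt_average lf fy) (lebesgue_pt_average lf fx)).
have xM : - M <= x <= M by rewrite -ler_norml /M -addrA lerDl addr_ge0.
have yM : - M <= y <= M by rewrite -ler_norml /M addrAC lerDr addr_ge0.
have AB : (fun n : nat =>
    \int[mu]_t (f t * (n.+1%:R * bump 0 1 ((t - y) * n.+1%:R)))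
   - \int[mu]_t (f t * (n.+1%:R * bump 0 1 ((t - x) * n.+1%:R)))) =
   (fun n : nat => - (\int[mu]_(t in `[- M, M])
       (g t * smooth_step ((t - y) * n.+1%:R))
     - \int[mu]_(t in `[- M, M]) (g t * smooth_step ((t - x) * n.+1%:R)))).
  apply/funext => n.
  have := weak _ (test_function_plateau y x (k0 n)).
  rewrite (derive1_is_derive (is_derive_plateau y x n.+1%:R)).
  set k : R := n.+1%:R in k0 *.
  have ki : k^-1 <= 1 by rewrite invf_le1 ?k0// ler1n.
  have cb u : continuous (fun t => k * bump 0 1 ((t - u) * k)).
    apply: continuousM1; first exact: continuous_cst1.
    apply: is_derive_continuous;
        exact: (is_derive_affine u k (is_derive_bump 0 1)).
  have bM u t : `|u| <= `|x| + `|y| ->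
      k * bump 0 1 ((t - u) * k) != 0 -> - M <= t <= M.
    move=> uM; apply: contraNT.
    rewrite -ler_norml -ltNge => tM;
        rewrite bump_eq0 ?mulr0// normrM (gtr0_norm (k0 n)).
    rewrite -ler_pdivrMr ?k0// mul1r (le_trans ki)//.
    by have := lerB_dist t u; rewrite /M in tM; lra.
  have xb : `|x| <= `|x| + `|y| by rewrite lerDl.
  have yb : `|y| <= `|x| + `|y| by rewrite lerDr.
  rewrite (@Rintegral_support _ (fun t => g t * _) `[- M, M]); last first.
    move=> t H; have /(plateau_support (k0 n)) : plateau y x k t != 0.
      by apply: contraNneq H => ->; rewrite mulr0.
    rewrite -/k /= in_itv/= /M => /andP[].
    move: ki; move: (k^-1) => z z1 H1 H2; apply/andP; split; lra.
  rewrite (@Rintegral_support _ (fun t => f t * _) `[- M, M]); last first.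
    move=> t; rewrite /= in_itv/=; apply: contraNT => H.
    have Hu u : `|u| <= `|x| + `|y| -> k * bump 0 1 ((t - u) * k) = 0.
      by move=> uM; apply/eqP/negP => /negP /(bM _ _ uM); exact/negP.
    by rewrite !Hu// subrr mulr0 eqxx.
  rewrite (@Rintegral_support _ (fun t => f t * (k * bump 0 1 ((t - y) * k)))
      `[- M, M]); last first.
    by move=> t H; rewrite /= in_itv/=; apply: (bM y) => //;
        apply: contraNneq H => ->; rewrite mulr0.
  rewrite (@Rintegral_support _ (fun t => f t * (k * bump 0 1 ((t - x) * k)))
      `[- M, M]); last first.
    by move=> t H; rewrite /= in_itv/=; apply: (bM x) => //;
        apply: contraNneq H => ->; rewrite mulr0.
  have lfb u := locally_integrableM lf (cb u).
  have lgs u := locally_integrableM lg (@continuous_step_affine u k).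
  rewrite -RintegralB//; try exact: locally_integrable_itv.
  rewrite -RintegralB//; try exact: locally_integrable_itv.
  have -> : (fun t => f t * (k * bump 0 1 ((t - y) * k)) - f t *
      (k * bump 0 1 ((t - x) * k)))
      = (fun t => f t * (k * bump 0 1 ((t - y) * k) - k * bump 0 1
          ((t - x) * k))).
    by apply/funext => t; rewrite mulrBr.
  have -> : (fun t => g t * smooth_step ((t - y) * k) - g t * smooth_step
      ((t - x) * k))
      = (fun t => g t * plateau y x k t).
    by apply/funext => t; rewrite -mulrBr.
  by [].
have B := cvgN (cvgB (smooth_step_cvg lg yM) (smooth_step_cvg lg xM)).
rewrite AB in A.
have H := cvg_unique (@Rhausdorff R) A (B _ _).
have N0 := @smooth_step1_gt0 R.
have : (f y - f x) * smooth_step 1 = (potential g y - potential g x) *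
    smooth_step 1.
  by rewrite mulrBl H; ring.
move=> /mulIf; rewrite gt_eqF// => /(_ isT); lra.
Qed.

End DuBoisReymond.

(** * Classical solutions on the line *)

Section Regularity.
Context {R : realType}.
Local Notation mu := (@lebesgue_measure R).
Implicit Types (f g h p pv U V phi : R -> R) (x y s t k l M : R).

Definition real_weak_derivative f g := forall phi, test_function phi ->
  \int[mu]_t (f t * derive1 phi t) = - \int[mu]_t (g t * phi t).

Lemma integrable_compact_support f M : locally_integrable setT f ->
  (forall t, f t != 0 -> - M <= t <= M) -> mu.-integrable setT (EFin \o f).
Proof.
move=> lf fM.
have -> : EFin \o f = (EFin \o f) \_ `[- M, M].
  apply/funext => t; rewrite patchE; case: ifPn => //.
  rewrite notin_setE /= in_itv/= => tM; congr EFin.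
  by apply/eqP/negP => /negP /fM.
apply/integrable_restrict => //; rewrite setTI; exact: locally_integrable_itv.
Qed.

Lemma integrable_test f phi : locally_integrable setT f -> test_function phi ->
  mu.-integrable setT (EFin \o (fun t => f t * phi t)).
Proof.
move=> lf tphi; have [M [_ HM]] := test_function_support tphi.
apply: (@integrable_compact_support _ M).
  by apply: locally_integrableM => //; exact: test_function_continuous.
by move=> t; rewrite mulf_eq0 negb_or => /andP[_ /HM].
Qed.

Lemma eq_potential f g : locally_integrable setT f ->
    locally_integrable setT g ->
  {ae mu, forall x, f x = g x} -> potential f = potential g.
Proof.
move=> [mf _ _] [mg _ _] fg; apply/funext => x.
have H a b : \int[mu]_(s in `[a, b]) f s = \int[mu]_(s in `[a, b]) g s.
  rewrite /Rintegral; congr fine; apply: ae_eq_integral => //.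
  - by apply/measurable_EFinP; exact: measurable_funS mf.
  - by apply/measurable_EFinP; exact: measurable_funS mg.
  - by apply: ae_imp fg => t /= -> _.
by rewrite /potential !H.
Qed.

(** Bootstrap: p is a primitive of pv, hence continuous; so pv is a primitive
of a continuous function, hence continuous, and p is of class C^2. *)
Lemma weak_ode_regular p pv V l :
  locally_integrable setT p -> locally_integrable setT pv -> continuous V ->
  real_weak_derivative p pv ->
  real_weak_derivative pv (fun t => p t * (V t - l)) ->
  exists U U1 : R -> R, [/\ (forall t, is_derive t (1 : R) U (U1 t)),
    (forall t, is_derive t (1 : R) U1 ((V t - l) * U t)),
    {ae mu, forall x, p x = U x} & {ae mu, forall x, pv x = U1 x}].
Proof.
move=> lp lpv cV w1 w2.
have cVl : continuous (fun t => V t - l).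
  by apply: continuousD1 => //; exact: continuous_cst1.
have lq := locally_integrableM lp cVl.
have [c1 E1] := weak_primitive lp lpv w1.
have [c2 E2] := weak_primitive lpv lq w2.
pose U t := c1 + potential pv t.
have cU : continuous U.
  by apply: continuousD1; [exact: continuous_cst1|exact: continuous_potential].
have cUV : continuous (fun t => U t * (V t - l)) by exact: continuousM1.
have PE : potential (fun t => p t * (V t - l)) = potential
    (fun t => U t * (V t - l)).
  apply: eq_potential => //; first exact: continuous_locally_integrable.
  by apply: ae_imp E1 => t ->.
rewrite PE in E2.
pose U1 t := c2 + potential (fun t => U t * (V t - l)) t.
have dU1 t : is_derive t (1 : R) U1 (U t * (V t - l)).
  have dP s := is_derive_potential s cUV.
  by rewrite /U1; derive; rewrite add0r.
have cU1 := is_derive_continuous dU1.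
exists U, U1; split => //.
- have UE : U = fun t => c1 + potential U1 t.
    rewrite /U (@eq_potential pv U1)//;
        first exact: continuous_locally_integrable.
  have dP s := is_derive_potential s cU1.
  by move=> t; rewrite UE; derive; rewrite add0r.
- by move=> t; apply: (is_derive_eq (dU1 t)); rewrite mulrC.
Qed.

Lemma Lfun2_locally_integrable f : f \in Lfun mu 2%:E ->
  locally_integrable setT f /\
      mu.-integrable setT (EFin \o (fun t => f t ^+ 2)).
Proof.
move=> f2; have if2 := Lfun2_integrable_sqr f2; split=> //.
have mf : measurable_fun setT f.
  by have := sub_Lfun_mfun f2; rewrite inE.
split; [exact: mf|exact: openT|move=> K _ cK].
have mK := compact_measurable cK.
have i1 : mu.-integrable K (EFin \o (fun _ : R => 1 : R)).
  by apply: continuous_compact_integrable => //;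
      exact/continuous_subspaceT/continuous_cst1.
have i2 : mu.-integrable K (EFin \o (fun t => f t ^+ 2)) by exact: integrableS
    if2.
have i12 := @integrableD _ _ _ mu K mK _ _ i1 i2.
have /integrableP[] // : mu.-integrable K (EFin \o f).
apply: (@le_integrable _ _ _ mu K mK _ _ _ _ i12).
  by apply/measurable_EFinP; exact: measurable_funS mf.
move=> t _ /=; rewrite lee_fin [leRHS]ger0_norm ?addr_ge0 ?sqr_ge0//.
rewrite ler_norml; apply/andP; split.
  by have := sqr_ge0 (f t + 1); have := sqr_ge0 (f t); lra.
by have := sqr_ge0 (f t - 1); have := sqr_ge0 (f t); lra.
Qed.

Lemma ae_integrable f g : mu.-integrable setT (EFin \o f) ->
  measurable_fun setT g -> {ae mu, forall x, f x = g x} ->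
  mu.-integrable setT (EFin \o g).
Proof.
move=> /integrableP[mf fi] mg fg; apply/integrableP; split.
  exact/measurable_EFinP.
rewrite (le_lt_trans _ fi)// le_eqVlt; apply/orP; left; apply/eqP.
apply: ae_eq_integral => //.
- by apply/measurableT_comp => //; exact/measurable_EFinP.
- exact/measurableT_comp.
- by apply: ae_imp fg => t /= -> _.
Qed.

Lemma integrable_prod f g : continuous f -> continuous g ->
  mu.-integrable setT (EFin \o (fun t => f t ^+ 2)) ->
  mu.-integrable setT (EFin \o (fun t => g t ^+ 2)) ->
  mu.-integrable setT (EFin \o (fun t => f t * g t)).
Proof.
move=> cf cg i1 i2; have i12 :=
    @integrableD _ _ _ mu setT measurableT _ _ i1 i2.
apply: (@le_integrable _ _ _ mu setT measurableT _ _ _ _ i12).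
  by apply/measurable_EFinP;
      exact: (continuous_measurable_fun (continuousM1 cf cg)).
move=> t _ /=; rewrite lee_fin [leRHS]ger0_norm ?addr_ge0 ?sqr_ge0//.
rewrite ler_norml; apply/andP; split.
  by have := sqr_ge0 (f t + g t); have := sqr_ge0 (f t); have := sqr_ge0 (g t);
      lra.
by have := sqr_ge0 (f t - g t); have := sqr_ge0 (f t); have := sqr_ge0 (g t);
    lra.
Qed.

(** An integrable function cannot stay above a positive constant on a set of
infinite measure. *)
Lemma integrable_ray_le0 h (D : set R) c : measurable D -> mu D = +oo%E ->
  mu.-integrable setT (EFin \o h) -> (forall t, D t -> c <= h t) -> c <= 0.
Proof.
move=> mD muD ih hc; rewrite leNgt; apply/negP => c0.
have iD : mu.-integrable D (EFin \o h) by exact: integrableS ih.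
have /integrableP[mh] := iD; rewrite ltNge => /negP; apply.
apply: (@le_trans _ _ (\int[mu]_(t in D) (cst c%:E) t)%E).
  rewrite (@integral_cst _ _ _ mu D mD) [X in (_ * X)%E](_ : _ = +oo%E) ?muD//.
  by rewrite mulry gtr0_sg// mul1e.
apply: (@ge0_le_integral _ _ _ mu D mD) => //.
- by move=> t _; rewrite lee_fin ltW.
- exact: measurableT_comp.
- by move=> t Dt /=; rewrite lee_fin (le_trans (hc t Dt))// ler_norm.
Qed.

Lemma integrable_right_le0 h c t0 : mu.-integrable setT (EFin \o h) ->
  (forall t, t0 <= t -> c <= h t) -> c <= 0.
Proof.
move=> ih hc; apply: (@integrable_ray_le0 h `[t0, +oo[ c) => //.
  by rewrite lebesgue_measure_itv/= ltry.
by move=> t /=; rewrite in_itv/= andbT => /hc.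
Qed.

Lemma integrable_left_le0 h c t0 : mu.-integrable setT (EFin \o h) ->
  (forall t, t <= t0 -> c <= h t) -> c <= 0.
Proof.
move=> ih hc; apply: (@integrable_ray_le0 h `]-oo, t0] c) => //.
  by rewrite lebesgue_measure_itv/= ltNyr.
Qed.

(** If l < 0 then U U1 is nondecreasing; being integrable on the whole line it
vanishes, and so does its derivative U1^2 + (V - l) U^2. *)
Lemma eigenvalue_ge0 (U U1 V : R -> R) l t0 :
  (forall t, is_derive t (1 : R) U (U1 t)) ->
  (forall t, is_derive t (1 : R) U1 ((V t - l) * U t)) ->
  mu.-integrable setT (EFin \o (fun t => U t ^+ 2)) ->
  mu.-integrable setT (EFin \o (fun t => U1 t ^+ 2)) ->
  (forall t, 0 <= V t) -> U t0 != 0 -> 0 <= l.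
Proof.
move=> dU dU1 iU iU1 V0 Ut0; rewrite leNgt; apply/negP => l0.
have iF := integrable_prod (is_derive_continuous dU) (is_derive_continuous dU1)
    iU iU1.
have dF t : is_derive t (1 : R) (fun t => U t * U1 t)
    (U1 t ^+ 2 + (V t - l) * U t ^+ 2).
  by derive; ring.
have F'0 t : 0 <= U1 t ^+ 2 + (V t - l) * U t ^+ 2.
  by rewrite addr_ge0 ?sqr_ge0// mulr_ge0 ?sqr_ge0// subr_ge0
      (le_trans (ltW l0)).
have Fle s t : s <= t -> U s * U1 s <= U t * U1 t.
  by move=> st; apply: (is_derive_le dF _ (lexx s) st (lexx t)).
have F0 t : U t * U1 t = 0.
  apply/eqP; rewrite eq_le; apply/andP; split.
    by apply: (integrable_right_le0 iF (t0 := t)) => s /Fle.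
  have iNF : mu.-integrable setT (EFin \o (fun t => - (U t * U1 t))).
    have := integrableN iF; apply: eq_integrable => // s _.
  rewrite -oppr_le0; apply: (integrable_left_le0 iNF (t0 := t)) => s /Fle.
  by rewrite lerN2.
have : is_derive t0 (1 : R) (fun _ : R => 0 :
    R) (U1 t0 ^+ 2 + (V t0 - l) * U t0 ^+ 2).
  have -> : (fun _ : R => 0 : R) = (fun t => U t * U1 t) by apply/funext => t;
      rewrite F0.
  exact: dF.
move=> /@derive_val; rewrite derive_cst => /esym/eqP.
rewrite gt_eqF// ltr_wpDl ?sqr_ge0// mulr_gt0 ?exprn_even_gt0//.
by rewrite subr_gt0 (lt_le_trans l0).
Qed.

(** Where the two equations agree the Wronskian is constant; on a half-line it
is also integrable. *)
Lemma wronskian_eq0 (U U1 Y Y1 VU VY : R -> R) r :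
  (forall t, is_derive t (1 : R) U (U1 t)) ->
  (forall t, is_derive t (1 : R) U1 (VU t * U t)) ->
  (forall t, is_derive t (1 : R) Y (Y1 t)) ->
  (forall t, is_derive t (1 : R) Y1 (VY t * Y t)) ->
  mu.-integrable setT (EFin \o (fun t => U t ^+ 2)) ->
  mu.-integrable setT (EFin \o (fun t => U1 t ^+ 2)) ->
  mu.-integrable setT (EFin \o (fun t => Y t ^+ 2)) ->
  mu.-integrable setT (EFin \o (fun t => Y1 t ^+ 2)) ->
  ((forall t, r <= t -> VU t = VY t) \/ (forall t, t <= r -> VU t = VY t)) ->
  U r * Y1 r - U1 r * Y r = 0.
Proof.
move=> dU dU1 dY dY1 iU iU1 iY iY1 VE.
have cU := is_derive_continuous dU; have cU1 := is_derive_continuous dU1.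
have cY := is_derive_continuous dY; have cY1 := is_derive_continuous dY1.
pose W t := U t * Y1 t - U1 t * Y t.
have dW t : is_derive t (1 : R) W ((VY t - VU t) * (U t * Y t)).
  by rewrite /W; derive; ring.
have iW : mu.-integrable setT (EFin \o W).
  have := @integrableB _ _ _ mu setT measurableT _ _
      (integrable_prod cU cY1 iU iY1) (integrable_prod cU1 cY iU1 iY).
  by apply: eq_integrable.
have iNW : mu.-integrable setT (EFin \o (fun t => - W t)).
  by have := integrableN iW; apply: eq_integrable.
rewrite -/(W r); apply/eqP; rewrite eq_le -(oppr_le0 (W r)).
case: VE => VE.
  have Wr t : r <= t -> W r = W t.
    move=> rt; apply: (is_derive0_cst dW _ (lexx r) rt (lexx t)).
    by move=> s /andP[/VE -> _]; rewrite subrr mul0r.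
  apply/andP; split.
    by apply: (integrable_right_le0 iW (t0 := r)) => t /Wr ->.
  by apply: (integrable_right_le0 iNW (t0 := r)) => t /Wr ->.
have Wr t : t <= r -> W r = W t.
  move=> tr; apply/esym; apply: (is_derive0_cst dW _ (lexx t) tr (lexx r)).
  by move=> s /andP[_ /VE ->]; rewrite subrr mul0r.
apply/andP; split.
  by apply: (integrable_left_le0 iW (t0 := r)) => t /Wr ->.
by apply: (integrable_left_le0 iNW (t0 := r)) => t /Wr ->.
Qed.

End Regularity.

(** * Eigenfunctions of h(0) *)

Section Eigenfunctions.
Context {R : realType}.
Local Notation mu := (@lebesgue_measure R).
Implicit Types (b bt : R -> R) (x y s t k l M : R).

(** Here p and pv stand for the real or imaginary parts of an eigenfunction and
of its weak derivative. Testing with the derivative of a test function shows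
that pv has the weak derivative (V - l) p. *)
Lemma classical_eigenfunction (V p pv : R -> R) l : continuous V ->
  p \in Lfun mu 2%:E -> pv \in Lfun mu 2%:E ->
  real_weak_derivative p pv ->
  (forall phi, test_function phi ->
    \int[mu]_t (p t * (- derive1n 2 phi t + V t * phi t)) =
    \int[mu]_t (l * p t * phi t)) ->
  ~ {ae mu, forall x, p x = 0} ->
  exists U U1 : R -> R, [/\ (forall t, is_derive t (1 : R) U (U1 t)),
    (forall t, is_derive t (1 : R) U1 ((V t - l) * U t)),
    (exists t, U t != 0),
    mu.-integrable setT (EFin \o (fun t => U t ^+ 2)) &
    mu.-integrable setT (EFin \o (fun t => U1 t ^+ 2))].
Proof.
move=> cV p2 pv2 w1 eqn pn0.
have [lp ip] := Lfun2_locally_integrable p2.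
have [lpv ipv] := Lfun2_locally_integrable pv2.
have w2 : real_weak_derivative pv (fun t => p t * (V t - l)).
  move=> phi tphi; have t1 := test_function_derive1 tphi; have t2 :=
      test_function_derive1 t1.
  have lpV := locally_integrableM lp cV.
  have H1 := w1 _ t1; have H2 := eqn _ tphi.
  have D2 : derive1n 2 phi = derive1 (derive1 phi) by rewrite derive1nS
      derive1n1.
  have E1 : \int[mu]_t (p t * (- derive1n 2 phi t + V t * phi t)) =
      \int[mu]_t (p t * V t * phi t) - \int[mu]_t
          (p t * derive1 (derive1 phi) t).
    rewrite -RintegralB//; try exact: integrable_test.
    by apply: eq_Rintegral => t _; rewrite D2; ring.
  have E2 : \int[mu]_t (p t * (V t - l) * phi t) =
      \int[mu]_t (p t * V t * phi t) - \int[mu]_t (l * p t * phi t).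
    have llp : locally_integrable setT (fun t => l * p t).
      have := locally_integrableM lp (@continuous_cst1 R l).
      by under eq_fun do rewrite mulrC.
    rewrite -RintegralB//; try exact: integrable_test.
    by apply: eq_Rintegral => t _; ring.
  by rewrite E2 -H2 E1 subKr H1 opprK.
have [U [U1 [dU dU1 E E1]]] := weak_ode_regular lp lpv cV w1 w2.
have sqr (f : R -> R) : (forall t, exists a : R, is_derive t (1 : R) f a) ->
    measurable_fun setT (fun t => f t ^+ 2).
  move=> df; apply: measurable_funX; apply: continuous_measurable_fun => t.
  have [a da] := df t; apply/differentiable_continuous/derivable1_diffP.
  exact: (@ex_derive _ _ _ _ _ _ _ da).
exists U, U1; split => //.
- apply: contrapT => H; apply: pn0; apply: ae_imp E => t ->.
  by apply/eqP/negP => /negP Ut; apply: H; exists t.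
- apply: ae_integrable ip _ _; first by apply: sqr => t; eexists; exact: dU.
  by apply: ae_imp E => t ->.
- apply: ae_integrable ipv _ _; first by apply: sqr => t; eexists; exact: dU1.
  by apply: ae_imp E1 => t ->.
Qed.

Lemma Re_mulr (z : R[i]) (a : R) : complex.Re (z * a%:C%C) = complex.Re z * a.
Proof. by case: z => x y /=; ring. Qed.

Lemma Im_mulr (z : R[i]) (a : R) : complex.Im (z * a%:C%C) = complex.Im z * a.
Proof. by case: z => x y /=; ring. Qed.

Lemma Cintegral_mulr (u : R -> R[i]) (phi : R -> R) :
  Cintegral (fun x => u x * (phi x)%:C%C) =
  ((\int[mu]_t (complex.Re (u t) * phi t)) +i*
   (\int[mu]_t (complex.Im (u t) * phi t)))%C.
Proof.
rewrite /Cintegral; congr (_ +i* _)%C; apply: eq_Rintegral => t _.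
  exact: Re_mulr.
exact: Im_mulr.
Qed.

Lemma eigenfunction b l : locally_integrable setT b -> h_eigenvalue b 0 l ->
  exists U U1 : R -> R, [/\ (forall t, is_derive t (1 : R) U (U1 t)),
    (forall t, is_derive t (1 : R) U1 ((potential b t ^+ 2 - l) * U t)),
    (exists t, U t != 0),
    mu.-integrable setT (EFin \o (fun t => U t ^+ 2)) &
    mu.-integrable setT (EFin \o (fun t => U1 t ^+ 2))].
Proof.
move=> lb [u [un0 [[[L2u [v [L2v wuv]]] _] _ eqn]]].
have VE : (fun x => (0 - potential b x) ^+ 2) = (fun x => potential b x ^+ 2).
  by apply/funext => x; rewrite sub0r sqrrN.
rewrite VE {VE} in eqn.
have cV : continuous (fun x => potential b x ^+ 2).
  have := continuousM1 (continuous_potential lb) (continuous_potential lb).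
  by under eq_fun do rewrite -expr2.
have weak phi (tphi : test_function phi) := wuv phi tphi.
have eqn' phi (tphi : test_function phi) := eqn phi tphi.
have [reu0|reu0] := pselect {ae mu, forall x, complex.Re (u x) = 0}; last first.
  apply: (@classical_eigenfunction _ (fun x => complex.Re (u x))
      (fun x => complex.Re (v x))) => //.
  - by case: L2u.
  - by case: L2v.
  - move=> phi /weak; rewrite !Cintegral_mulr.
    by move=> /(congr1 (@complex.Re R)).
  - move=> phi /eqn'; rewrite !Cintegral_mulr.
    move=> /(congr1 (@complex.Re R)) /= ->; apply: eq_Rintegral => t _.
    by rewrite [l%:C%C * _]mulrC Re_mulr [_ * l]mulrC.
apply: (@classical_eigenfunction _ (fun x => complex.Im (u x))
    (fun x => complex.Im (v x))) => //.
- by case: L2u.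
- by case: L2v.
- move=> phi /weak; rewrite !Cintegral_mulr.
  by move=> /(congr1 (@complex.Im R)).
- move=> phi /eqn'; rewrite !Cintegral_mulr.
  move=> /(congr1 (@complex.Im R)) /= ->; apply: eq_Rintegral => t _.
  by rewrite [l%:C%C * _]mulrC Im_mulr [_ * l]mulrC.
- move=> imu0; apply: un0; apply: ae_imp (ae_and reu0 imu0) => t [H1 H2].
  by apply/eqP; rewrite eq_complex H1 H2 !eqxx.
Qed.

(** This makes the common eigenvalue independent of eps. *)
Lemma is_lambda1_unique b xi l l' : is_lambda b 1 xi l -> is_lambda b 1 xi l' ->
    l = l'.
Proof.
have none m m' : is_lambda b 1 xi m -> h_eigenvalue b xi m' -> m <= m'.
  move=> [_ _]; rewrite /= II0 card_eq0 => /eqP H em'.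
  rewrite leNgt; apply/negP => m'm.
  suff : [set m0 | h_eigenvalue b xi m0 /\ m0 < m] m' by rewrite H.
  by [].
move=> H H'; apply/eqP; rewrite eq_le (none _ _ H)/= ?(none _ _ H')//.
  by case: H.
by case: H'.
Qed.

End Eigenfunctions.

(** * Potentials of magnetic fields *)

Section Fields.
Context {R : realType}.
Local Notation mu := (@lebesgue_measure R).
Implicit Types (b bt : R -> R) (x y s t k l M : R).

Lemma magnetic_field_bounds bm bp b : magnetic_field bm bp b ->
  forall x, bm <= b x <= bp.
Proof.
move=> [_ mono lm lp] x; apply/andP; split.
  apply: (cvgr_to_le lm); near=> y; apply: mono.
  by near: y; apply: nbhs_ninfty_le; exact: num_real.
apply: (cvgr_to_ge lp); near=> y; apply: mono.
by near: y; apply: nbhs_pinfty_ge; exact: num_real.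
Unshelve. all: by end_near. Qed.

Lemma magnetic_field_locally_integrable bm bp b : magnetic_field bm bp b ->
  locally_integrable setT b.
Proof.
move=> hb; have bd := magnetic_field_bounds hb.
have mb : measurable_fun setT b.
  by case: hb => _ mono _ _; exact: nondecreasing_measurable.
split; [exact: mb|exact: openT|move=> K _ cK].
have mK := compact_measurable cK.
have i1 : mu.-integrable K (EFin \o (fun _ : R => `|bm| + `|bp|)).
  by apply: continuous_compact_integrable => //;
      exact/continuous_subspaceT/continuous_cst1.
have /integrableP[] // : mu.-integrable K (EFin \o b).
apply: (@le_integrable _ _ _ mu K mK _ _ _ _ i1).
  by apply/measurable_EFinP; exact: measurable_funS mb.
move=> t _ /=; rewrite lee_fin [leRHS]ger0_norm ?addr_ge0//.
have /andP[b1 b2] := bd t; rewrite ler_norml.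
have := ler_norm bp; have := ler_norm (- bm); rewrite normrN.
have := normr_ge0 bm; have := normr_ge0 bp; lra.
Qed.

(** The potential vanishes at 0, and its increments lie between 0 and bp times
those of the variable. *)
Lemma potential_bound bm bp b r t : 0 <= bm -> magnetic_field bm bp b ->
  - r <= t <= r -> `|potential b t| <= bp * r.
Proof.
move=> bm0 hb /andP[rt tr].
have lb := magnetic_field_locally_integrable hb.
have bd := magnetic_field_bounds hb.
have r0 : 0 <= r by lra.
have bp0 : 0 <= bp by have /andP[] := bd 0; lra.
have main x y : x <= y -> 0 <= potential b y - potential b x <= bp * (y - x).
  move=> xy; rewrite potentialB//; apply/andP; split.
    by apply: Rintegral_ge0 => s _; have /andP[] := bd s; lra.
  have <- : \int[mu]_(s in `[x, y]) (fun _ => bp) s = bp * (y - x).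
    rewrite Rintegral_cst//= lebesgue_measure_itv/= lte_fin.
    by case: ltgtP xy => // -> _; rewrite subrr mulr0.
  apply: le_Rintegral => //; first exact: locally_integrable_itv.
    exact/locally_integrable_itv/locally_integrable_cst.
  by move=> s _; have /andP[] := bd s.
have [t0|t0] := leP 0 t.
  have := main _ _ t0; rewrite potential0 !subr0 => /andP[p0 pt].
  by rewrite ger0_norm// (le_trans pt)// ler_wpM2l.
have := main _ _ (ltW t0); rewrite potential0 !sub0r => /andP[p0 pt].
rewrite ler0_norm; last by lra.
by rewrite (le_trans pt)// ler_wpM2l//; lra.
Qed.

Lemma locally_integrable_b_eps b bt eps : locally_integrable setT b ->
  locally_integrable setT bt -> locally_integrable setT (b_eps b bt eps).
Proof.
move=> lb lbt.
have H1 := locally_integrableM lb (@continuous_cst1 R (1 - eps)).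
have H2 := locally_integrableM lbt (@continuous_cst1 R eps).
have := locally_integrableD H1 H2.
by congr locally_integrable; apply/funext => x; rewrite /b_eps/=; ring.
Qed.

Lemma potential_b_eps b bt eps t : locally_integrable setT b ->
  locally_integrable setT bt ->
  potential (b_eps b bt eps) t =
  potential b t + eps * (potential bt t - potential b t).
Proof.
move=> lb lbt.
have H x y : \int[mu]_(s in `[x, y]) b_eps b bt eps s =
    (1 - eps) * \int[mu]_(s in `[x, y]) b s + eps * \int[mu]_(s in `[x, y]) bt
        s.
  have lb' := locally_integrable_itv x y lb.
  have lbt' := locally_integrable_itv x y lbt.
  rewrite -RintegralZl// -RintegralZl// -RintegralD//.
  - exact: (@integrableZl _ _ _ mu _ (measurable_itv _) (1 - eps) _ lb').
  - exact: (@integrableZl _ _ _ mu _ (measurable_itv _) eps _ lbt').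
by rewrite /potential !H; case: ifP => _; ring.
Qed.

End Fields.

(** * The theorem *)

Theorem theorem2p1 (R : realType) (bm bp : R)
    (hbm : 0 < bm) (hbmp : bm < bp) (hbp : bp < 3 * bm)
    (b bt : R -> R)
    (hb : magnetic_field bm bp b) (hbt : magnetic_field bm bp bt)
    (r : R) (hr0 : 0 < r) (hr : r < Num.sqrt (3 * bm - bp) / (2 * bp))
    (hsupp : tsupport (fun x => potential bt x - potential b x) `<=` `[- r, r])
    (hacc : limit_point (coincidence_set b bt) 0) :
  {ae (@lebesgue_measure R), forall x, bt x = b x}.
Proof.
have lb := magnetic_field_locally_integrable hb.
have lbt := magnetic_field_locally_integrable hbt.
have bp0 : 0 < bp by lra.
(* 4 bp^2 r^2 < 3 bm - bp < 2 bp, that is 2 bp r^2 < 1 *)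
have rbp : 4 * bp ^+ 2 * r ^+ 4 <= 1.
  have h1 : 2 * bp * r < Num.sqrt (3 * bm - bp).
    by rewrite mulrC -ltr_pdivlMr// mulr_gt0.
  have h2 : (2 * bp * r) ^+ 2 < 3 * bm - bp.
    have h0 : 0 <= 3 * bm - bp by lra.
    have n0 : 0 <= 2 * bp * r by rewrite mulr_ge0// ?ltW// mulr_gt0.
    by rewrite -[ltRHS](sqr_sqrtr h0) ltr_sqr ?nnegrE ?sqrtr_ge0.
  have h3 : 2 * bp * r ^+ 2 < 1.
    have : bp * (2 * (2 * bp * r ^+ 2)) < bp * 2.
      apply: le_lt_trans (_ : (2 * bp * r) ^+ 2 < _); last by lra.
      by rewrite le_eqVlt; apply/orP; left; apply/eqP; ring.
    by rewrite ltr_pM2l// -[ltRHS]mulr1 ltr_pM2l.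
  have -> : 4 * bp ^+ 2 * r ^+ 4 = (2 * bp * r ^+ 2) ^+ 2 by ring.
  have n0 : 0 <= 2 * bp * r ^+ 2 by rewrite mulr_ge0 ?sqr_ge0// ltW// mulr_gt0.
  by rewrite expr_le1//; exact: ltW.
set w := fun x => potential bt x - potential b x.
have cw : continuous w.
  by apply: continuousD1; [|apply: continuousN1]; exact: continuous_potential.
have wr t : w t != 0 -> - r <= t <= r.
  move=> wt; have ts : tsupport w t by exact: subset_closure.
  by have := hsupp t ts; rewrite /= in_itv.
have wr0 t : r <= `|t| -> w t = 0.
  move=> rt; apply/eqP/negP => /negP /(support_interior cw wr).
  by rewrite -ltr_norml ltNge rt.
have small d : 0 < d -> exists eps l, [/\ 0 < eps <= 1, eps < d,
    is_lambda (b_eps b bt eps) 1 0 l & is_lambda b 1 0 l].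
  move=> d0; have [eps [_ [epsI [l [h1 h2]]] /= ed]] :=
      hacc _ (nbhsx_ballx (0 : R) d d0).
  exists eps, l; split => //; move: ed;
      rewrite /ball/= sub0r normrN gtr0_norm//.
  by case/andP: epsI.
have [_ [l [_ _ _ bl]]] := small _ ltr01.
have el : h_eigenvalue b 0 l by case: bl.
have [u [u1 [du du1 [t0 ut0] iu iu1]]] := eigenfunction lb el.
have l0 : 0 <= l by apply: (eigenvalue_ge0 du du1 iu iu1 _ ut0) => t;
    exact: sqr_ge0.
have w0 : forall t, w t = 0.
  apply: (@robin_rigidity _ (potential b) w u u1 l r bp) => //.
  - exact: continuous_potential.
  - by exists t0.
  - by move=> t; apply: potential_bound hb; exact: ltW.
  move=> d d0; have [eps [l' [/andP[eps0 eps1] ed el' bl']]] := small d d0.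
  have ll' := is_lambda1_unique bl bl'; rewrite -{}ll' {l' bl'} in el'.
  exists eps; split => //.
    move=> t tI.
    have -> : potential b t + eps * w t = (1 - eps) * potential b t +
        eps * potential bt t.
      by rewrite /w; ring.
    have B1 := potential_bound (ltW hbm) hb tI.
    have B2 := potential_bound (ltW hbm) hbt tI.
    rewrite (le_trans (ler_normD _ _))// !normrM (gtr0_norm eps0) ger0_norm
        ?subr_ge0//.
    have -> : bp * r = (1 - eps) * (bp * r) + eps * (bp * r) by ring.
    by rewrite lerD// ler_wpM2l// ?subr_ge0// ltW.
  have {}el' : h_eigenvalue (b_eps b bt eps) 0 l by case: el'.
  have lbe := locally_integrable_b_eps eps lb lbt.
  have [y [y1 [dy dy1 [s0 ys0] iy iy1]]] := eigenfunction lbe el'.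
  have VE t : potential (b_eps b bt eps) t = potential b t + eps * w t.
    exact: potential_b_eps.
  have dy1' t : is_derive t (1 :
      R) y1 (((potential b t + eps * w t) ^+ 2 - l) * y t).
    by rewrite -VE.
  have cQ : continuous (fun t => (potential b t + eps * w t) ^+ 2 - l).
    have ca : continuous (fun t => potential b t + eps * w t).
      apply: continuousD1; first exact: continuous_potential.
      by apply: continuousM1 => //; exact: continuous_cst1.
    have := continuousD1 (continuousM1 ca ca) (@continuous_cst1 R (- l)).
    by under eq_fun do rewrite -expr2.
  have Wr : u r * y1 r - u1 r * y r = 0.
    apply: (wronskian_eq0 du du1 dy dy1' iu iu1 iy iy1); left => t rt.
    by rewrite wr0 ?mulr0 ?addr0// (le_trans rt)// ler_norm.
  have Wl : u (- r) * y1 (- r) - u1 (- r) * y (- r) = 0.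
    apply: (wronskian_eq0 du du1 dy dy1' iu iu1 iy iy1); right => t tr.
    have rt : r <= `|t| by rewrite ler0_norm; lra.
    by rewrite wr0// mulr0 addr0.
  (* as the Wronskian vanishes at - r, the data there are proportional *)
  have [c [c0 c1]] : exists c, c * y (- r) = u (- r) /\ c * y1 (- r) = u1 (- r).
    have [yr|yr] := eqVneq (y (- r)) 0.
      have y1r : y1 (- r) != 0.
        apply/eqP => y1r; have [] := ode_unique cQ dy dy1' yr y1r s0.
        by move/eqP; rewrite (negbTE ys0).
      exists (u1 (- r) / y1 (- r)); rewrite divfK// yr mulr0; split => //.
      move/eqP: Wl; rewrite yr mulr0 subr0 mulf_eq0 (negbTE y1r) orbF.
      by move/eqP.
    exists (u (- r) / y (- r)); rewrite divfK//; split => //.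
    apply: (mulIf yr); rewrite mulrAC divfK//; lra.
  exists (fun t => c * y t), (fun t => c * y1 t); split => //.
  - by move=> t; derive; rewrite mul0r add0r.
  - by move=> t; derive; ring.
  - by rewrite mulrCA [u1 r * _]mulrCA -mulrBr Wr mulr0.
have PE : potential bt = potential b.
  by apply/funext => t; apply/eqP; rewrite -subr_eq0; apply/eqP; exact: w0.
have A := ae_and (lebesgue_differentiation lbt) (lebesgue_differentiation lb).
apply: ae_imp A => x [H1 H2].
have := is_derive_potential_lebesgue_pt lbt H1; rewrite PE => /@derive_val <-.
by have := is_derive_potential_lebesgue_pt lb H2 => /@derive_val.
Qed.
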